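(* Let $\gamma\in(0,2)$, $T>0$, let $m\ge2$ be an integer, and let $g:\mathbb{R}\to[0,1]$ be measurable. Let $\rho_1,\rho_2:[0,T]\times\mathbb{R}\to[0,1]$ be such that $\rho_1-b,\ \rho_2-b\in L^2(0,T;L^2(\mathbb{R}))$ and $\rho_1^m-b^m,\ \rho_2^m-b^m\in L^2(0,T;\mathcal{H}^{\gamma/2})$ for some $b\in(0,1)$. If $$F(t,\rho_1,G,g)=0=F(t,\rho_2,G,g)\qquad\text{for every }t\in[0,T]\text{ and every }G\in\mathcal{S},$$ where $$F(t,\rho,G,g):=\langle\rho_t,G_t\rangle-\langle g,G_0\rangle-\int_0^t\langle\rho_s,\partial_sG_s\rangle ds-\int_0^t\langle\rho_s^m,[-(-\Delta)^{\gamma/2}G_s]\rangle ds,$$ then $\rho_1=\rho_2$ almost everywhere in $[0,T]\times\mathbb{R}$.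
   Context: $\langle f,h\rangle=\int_{\mathbb{R}}f(u)h(u)du$, and $\rho_t=\rho(t,\cdot)$, $G_t=G(t,\cdot)$. $\mathcal{S}$ is the set of functions $G(t,u)=\sum_{j=0}^kt^jG_j(u)$ on $[0,T]\times\mathbb{R}$ with $k\in\mathbb{N}$ and $G_0,\dots,G_k\in C_c^\infty(\mathbb{R})$. The fractional Laplacian acts on the space variable by $[-(-\Delta)^{\gamma/2}G](u)=c_\gamma\lim_{\varepsilon\to0^+}\int_{\mathbb{R}}\mathbf{1}_{\{|u-v|\ge\varepsilon\}}\frac{G(v)-G(u)}{|u-v|^{1+\gamma}}dv$, where $c_\gamma>0$ is the constant such that $\sum_{z\in\mathbb{Z}\setminus\{0\}}c_\gamma|z|^{-\gamma-1}=1$. $\mathcal{H}^{\gamma/2}$ is the space of $f\in L^2(\mathbb{R})$ with $\iint_{\mathbb{R}^2}\frac{[f(u)-f(v)]^2}{|u-v|^{1+\gamma}}dudv<\infty$, with norm $\|f\|^2_{\mathcal{H}^{\gamma/2}}=\int_{\mathbb{R}}f^2+\iint_{\mathbb{R}^2}\frac{[f(u)-f(v)]^2}{|u-v|^{1+\gamma}}dudv$. For $N\subset L^2(\mathbb{R})$ with norm $\|\cdot\|_N$, $L^2(0,T;N)$ is the set of measurable $f:[0,T]\times\mathbb{R}\to\mathbb{R}$ with $f(s,\cdot)\in N$ for a.e. $s\in[0,T]$ and $\int_0^T\|f(s,\cdot)\|_N^2ds<\infty$. *)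

(* Defs.v *)
From HB Require Import structures.
From mathcomp Require Import all_boot all_order all_algebra.
From mathcomp Require Import all_classical all_reals all_analysis.

Set Implicit Arguments.
Unset Strict Implicit.
Unset Printing Implicit Defensive.

Import Order.TTheory GRing.Theory Num.Theory.
Import numFieldNormedType.Exports.

Local Open Scope classical_set_scope.
Local Open Scope ring_scope.

(* A function of (t, u) is curried, [f : R -> R -> R], so that [f t] is the
   paper's f_t.  A function on [0, T] x R is represented by a total function
   whose values at times outside [0, T] are never used. *)

Section definitions.
Context {R : realType}.
Implicit Types (f h G g : R -> R) (T b t c gamma : R).

Local Notation mu := (@lebesgue_measure R).

Definition inner f h : R := \int[mu]_u (f u * h u).

Definition smooth f : Prop :=
  forall (n : nat) (x : R), derivable (derive1n n f) x 1.

Definition Ccinfty f : Prop :=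
  smooth f /\ compact (closure [set x | f x != 0]).

(* The elements of S, being polynomial in t, are taken on all of R x R: their
   time derivative at 0 and T is then the one-sided derivative of the
   restriction to [0, T]. *)
Definition test_functions : set (R -> R -> R) :=
  [set G | exists (k : nat) (Gs : 'I_k.+1 -> R -> R),
    (forall j, Ccinfty (Gs j)) /\
    G = fun t u => \sum_(j < k.+1) t ^+ j * Gs j u].

Definition time_derivative (G : R -> R -> R) : R -> R -> R :=
  fun s u => derive1 (G ^~ u) s.

Definition is_jump_constant gamma c : Prop :=
  0 < c /\
  \esum_(z in [set z : int | z != 0]) (c * `|z%:~R| `^ (- gamma - 1))%:E
    = 1%:E.

Definition jump_constant gamma : R := get (is_jump_constant gamma).

(* The operator - (- Delta)^(gamma / 2), sign included. *)
Definition fractional_laplacian gamma G : R -> R := fun u =>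
  jump_constant gamma *
  lim ((fun eps : R =>
          \int[mu]_v (\1_[set v' : R | eps <= `|u - v'|] v *
            ((G v - G u) / `|u - v| `^ (1 + gamma)))) @ 0^'+).

Definition L2 : set (R -> R) := [set f | f \in Lfun mu 2%:E].

Definition L2_norm f : \bar R := 'N[mu]_2%:E[EFin \o f].

Definition gagliardo gamma f : \bar R :=
  (\int[mu \x mu]_z
     ((f z.1 - f z.2) ^+ 2 / `|z.1 - z.2| `^ (1 + gamma))%:E)%E.

Definition sobolev gamma : set (R -> R) :=
  [set f | L2 f /\ (gagliardo gamma f < +oo)%E].

Definition sobolev_norm gamma f : \bar R :=
  ((\int[mu]_u (f u ^+ 2)%:E + gagliardo gamma f) `^ 2^-1)%E.

(* L^2(0, T; N), for a space N whose norm is given as an extended real. *)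
Definition L2_time T (N : set (R -> R)) (norm : (R -> R) -> \bar R) :
    set (R -> R -> R) :=
  [set f |
    [/\ measurable_fun (`[0, T] `*` [set: R])
          (fun z : measurableTypeR R * measurableTypeR R => f z.1 z.2),
        {ae mu, forall s : R, s \in `[0, T] -> N (f s)} &
        (\int[mu]_(s in `[0%R, T]) (norm (f s) ^+ 2) < +oo)%E]].

Definition weak_F gamma (m : nat) t (rho G : R -> R -> R) g : R :=
  inner (rho t) (G t) - inner g (G 0)
  - \int[mu]_(s in `[0, t]) inner (rho s) (time_derivative G s)
  - \int[mu]_(s in `[0, t])
      inner (fun u => rho s u ^+ m) (fractional_laplacian gamma (G s)).

End definitions.

(* Main.v *)
Require Import Defs.
From HB Require Import structures.
From mathcomp Require Import all_boot all_order all_algebra.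
From mathcomp Require Import all_classical all_reals all_analysis.
From mathcomp Require Import measurable_realfun ring lra.

Set Implicit Arguments.
Unset Strict Implicit.
Unset Printing Implicit Defensive.

Import Order.TTheory GRing.Theory Num.Theory.
Import numFieldNormedType.Exports.

Local Open Scope classical_set_scope.
Local Open Scope ring_scope.

(** Why the solution is unique.  Put w = rho1 - rho2 and W = rho1^m - rho2^m,
    both extended by 0 to times outside [0, T].  It is enough to show that the
    integral of w W over time and space is at most 0: since 0 <= rho1, rho2,
    the product w W is nonnegative and vanishes only where rho1 = rho2.

    Testing the two weak equations with G(s, u) = zeta(x - u), for a bump
    function zeta, and subtracting gives for every t in [0, T] and every x

      (w_t * zeta)(x) = C int_0^t int W_s(y) int Theta(x - y, h) dh dy ds,

    where C = c_gamma / 2 and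
    Theta(u, h) = k(h) (zeta(u + h) + zeta(u - h) - 2 zeta(u)) is the second
    difference of zeta weighted by the jump kernel k(h) = |h|^(-1-gamma)
    ([fractional_laplacian_reflected], [mollified_weak_equation]).  Put
    Om_t = W_t * zeta, F_t(x) = int_0^t Om_s(x) ds and P = F_T.  By Fubini the
    right-hand side is C int k(h) (F_t(x + h) + F_t(x - h) - 2 F_t(x)) dh.
    Now multiply by Om_t = dF_t/dt and integrate in t and x.  For each h the
    time integral is that of an exact derivative ([primitive_product]), and
    what remains is the integral of P(x + h) P(x) - P(x)^2, which is at most 0
    ([correlation_le0]).  Hence the integral of (w * zeta)(W * zeta) is at most
    0 ([energy_le0]).  The exchanges of integrals are justified by Young's
    inequality, as w and W are square integrable and Theta is integrable.

    To remove zeta, let zeta_n be a sequence of mollifiers.  Since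
    convolution with zeta_n does not increase the L^2 norm, the inequality just
    obtained gives

      || w * zeta_n + W * zeta_n ||^2 <= || w ||^2 + || W ||^2.

    The convolutions converge at Lebesgue points ([mollifier_cvg]), so Fatou's
    lemma yields || w + W ||^2 <= || w ||^2 + || W ||^2 ([sum_sqr_le]), which
    says that the integral of w W is at most 0. *)

(** * Reflection invariance and Fubini for real-valued integrals *)

Section reflection.
Context {R : realType}.
Local Notation mu := (@lebesgue_measure R).
Local Notation RR := (measurableTypeR R).

Lemma measurable_reflection (a : R) :
  measurable_fun [set: RR] ((fun x : RR => a - x) : RR -> RR).
Proof. exact: (@measurable_funB _ _ _ _ (fun=> a) (fun x => x)). Qed.

Lemma measurable_translation (a : R) :
  measurable_fun [set: RR] ((fun x : RR => x + a) : RR -> RR).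
Proof. exact: (@measurable_funD _ _ _ _ (fun x => x) (fun=> a)). Qed.

Lemma lebesgue_measure_reflection (a : R) (A : set R) : measurable A ->
  pushforward mu ((fun x : R => a - x) : _ -> RR) A = mu A.
Proof.
move=> mA; apply/esym/lebesgue_measure_unique => //=.
  exact: measurable_reflection.
move=> _ mf [[l r] _ <-].
rewrite /pushforward.
rewrite (_ : _ @^-1` _ = `[a - r, a - l[%classic); last first.
  apply/seteqP; split => x /=; rewrite !in_itv /=; lra.
rewrite !lebesgue_measure_itv /= !lte_fin.
rewrite (_ : (a - r < a - l) = (l < r)); last by apply/idP/idP; lra.
by case: ifP => // _; rewrite -!EFinB; congr EFin; lra.
Qed.

(** No integrability is needed: the positive and the negative part are
    treated separately. *)
Lemma integral_reflection (a : R) (f : R -> \bar R) :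
  measurable_fun [set: RR] f ->
  (\int[mu]_x f (a - x)%R = \int[mu]_x f x)%E.
Proof.
have H (g : R -> \bar R) : measurable_fun [set: RR] g -> (forall x, 0 <= g x)%E ->
  (\int[mu]_x g (a - x)%R = \int[mu]_x g x)%E.
  move=> mg g0.
  have := @ge0_integral_pushforward _ _ _ _ R _ (measurable_reflection a) mu setT g.
  rewrite preimage_setT => /(_ measurableT mg (fun x _ => g0 x)) <-.
  apply: eq_measure_integral => [|mf A mA _]; first exact: measurable_reflection.
  exact: lebesgue_measure_reflection.
move=> mf; rewrite integralE [RHS]integralE; congr (_ - _)%E.
  transitivity (\int[mu]_x f^\+ (a - x)%R)%E; last by apply: H => //; exact: measurable_funepos.
  by apply: eq_integral => x _; rewrite !funeposE.
transitivity (\int[mu]_x f^\- (a - x)%R)%E; last by apply: H => //; exact: measurable_funeneg.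
by apply: eq_integral => x _; rewrite !funenegE.
Qed.

Lemma integral_translation (a : R) (f : R -> \bar R) :
  measurable_fun [set: RR] f ->
  (\int[mu]_x f (x + a)%R = \int[mu]_x f x)%E.
Proof.
move=> mf; rewrite -[RHS](integral_reflection a)//.
rewrite -[LHS](integral_reflection 0); last first.
  exact: (measurableT_comp mf (measurable_translation a)).
by apply: eq_integral => x _; congr f; lra.
Qed.

Lemma Rintegral_reflection (a : R) (f : R -> R) : measurable_fun [set: RR] f ->
  \int[mu]_x f (a - x) = \int[mu]_x f x.
Proof.
move=> mf; rewrite /Rintegral (@integral_reflection a (EFin \o f))//.
exact/measurable_EFinP.
Qed.

Lemma Rintegral_translation (a : R) (f : R -> R) : measurable_fun [set: RR] f ->
  \int[mu]_x f (x + a) = \int[mu]_x f x.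
Proof.
move=> mf; rewrite /Rintegral (@integral_translation a (EFin \o f))//.
exact/measurable_EFinP.
Qed.

Lemma integrable_reflection (a : R) (f : R -> R) :
  mu.-integrable [set: RR] (EFin \o f) ->
  mu.-integrable [set: RR] (fun x => (f (a - x))%:E).
Proof.
move=> /integrableP[mf ioo]; apply/integrableP; split.
  exact: (measurableT_comp mf (measurable_reflection a)).
rewrite (@integral_reflection a (fun x => `|(f x)%:E|)%E)//.
exact: measurableT_comp.
Qed.

Lemma integrable_translation (a : R) (f : R -> R) :
  mu.-integrable [set: RR] (EFin \o f) ->
  mu.-integrable [set: RR] (fun x => (f (x + a))%:E).
Proof.
move=> /integrableP[mf ioo]; apply/integrableP; split.
  exact: (measurableT_comp mf (measurable_translation a)).
rewrite (@integral_translation a (fun x => `|(f x)%:E|)%E)//.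
exact: measurableT_comp.
Qed.

End reflection.

Lemma abse_fine_le (R : realType) (e : \bar R) : (`|(fine e)%:E| <= `|e|)%E.
Proof. by case: e => //=; rewrite normr0 leey. Qed.

Section real_fubini.
Context d1 d2 (X : measurableType d1) (Y : measurableType d2) (R : realType).
Variables (m1 : {sigma_finite_measure set X -> \bar R})
          (m2 : {sigma_finite_measure set Y -> \bar R}).
Implicit Types f : X -> Y -> R.

(** No integrability is needed, as the integral of a function is always the
    difference of those of its positive and negative parts. *)
Lemma measurable_Rintegral f :
  measurable_fun [set: X * Y] (fun z => f z.1 z.2) ->
  measurable_fun [set: X] (fun x => \int[m2]_y f x y).
Proof.
move=> mf; apply: (measurableT_comp (fine_measurable measurableT)).
have mEf : measurable_fun [set: X * Y] (fun z => (f z.1 z.2)%:E).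
  exact/measurable_EFinP.
rewrite (_ : (fun x => _) = (fun x => \int[m2]_y ((fun z => (f z.1 z.2)%:E)^\+ (x, y))
  - \int[m2]_y ((fun z => (f z.1 z.2)%:E)^\- (x, y)))%E); last first.
  apply/funext => x; rewrite integralE; congr (_ - _)%E.
    by apply: eq_integral => y _; rewrite !funeposE.
  by apply: eq_integral => y _; rewrite !funenegE.
apply: emeasurable_funB.
- exact: (@measurable_fun_fubini_tonelli_F _ _ _ _ _ m2
    (fun z => (f z.1 z.2)%:E)^\+%E (measurable_funepos mEf)).
- exact: (@measurable_fun_fubini_tonelli_F _ _ _ _ _ m2
    (fun z => (f z.1 z.2)%:E)^\-%E (measurable_funeneg mEf)).
Qed.

Lemma integrable_prod f :
  measurable_fun [set: X * Y] (fun z => f z.1 z.2) ->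
  (\int[m1]_x \int[m2]_y `|f x y|%:E < +oo)%E ->
  (m1 \x m2)%E.-integrable [set: X * Y] (fun z => (f z.1 z.2)%:E).
Proof.
by move=> mf fy; apply/integrable12ltyP => //; exact/measurable_EFinP.
Qed.

Lemma integrable_Rintegral f :
  (m1 \x m2)%E.-integrable [set: X * Y] (fun z => (f z.1 z.2)%:E) ->
  m1.-integrable [set: X] (fun x => (\int[m2]_y f x y)%:E).
Proof.
move=> fi; have /integrableP[mF Foo] := integrable_fubini_F fi.
have mI : measurable_fun [set: X] (fun x => (\int[m2]_y f x y)%:E).
  apply/measurable_EFinP/measurable_Rintegral.
  by apply/measurable_EFinP; exact: (measurable_int _ fi).
apply/integrableP; split => //.
apply: le_lt_trans Foo; apply: ge0_le_integral => //.
- exact: measurableT_comp.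
- exact: measurableT_comp.
- by move=> x _; exact: abse_fine_le.
Qed.

Lemma Rintegral12 f :
  (m1 \x m2)%E.-integrable [set: X * Y] (fun z => (f z.1 z.2)%:E) ->
  \int[m1]_x \int[m2]_y f x y = \int[(m1 \x m2)%E]_z f z.1 z.2.
Proof.
move=> fi; rewrite [RHS]/Rintegral -(integral12_prod_meas1 fi).
congr fine; apply: ae_eq_integral => //.
- exact: measurable_int _ (integrable_Rintegral fi).
- exact: measurable_int _ (integrable_fubini_F fi).
- have := integrable_ae measurableT (integrable_fubini_F fi).
  by apply: filterS => x /= /(_ I) /fineK Fx _; rewrite -[in RHS]Fx.
Qed.

End real_fubini.

Section real_fubini_swap.
Context d1 d2 (X : measurableType d1) (Y : measurableType d2) (R : realType).
Variables (m1 : {sigma_finite_measure set X -> \bar R})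
          (m2 : {sigma_finite_measure set Y -> \bar R}).
Implicit Types f : X -> Y -> R.

Lemma measurable_swapped f :
  measurable_fun [set: X * Y] (fun z => f z.1 z.2) ->
  measurable_fun [set: Y * X] (fun z => f z.2 z.1).
Proof.
move=> mf.
exact: (measurableT_comp mf (@measurable_swap _ _ Y X)).
Qed.

Lemma integrable_swapped f :
  (m1 \x m2)%E.-integrable [set: X * Y] (fun z => (f z.1 z.2)%:E) ->
  (m2 \x m1)%E.-integrable [set: Y * X] (fun z => (f z.2 z.1)%:E).
Proof.
move=> fi; have mf := measurable_int _ fi.
have mf' : measurable_fun [set: X * Y] (fun z => f z.1 z.2).
  exact/measurable_EFinP.
apply: (@integrable_prod _ _ _ _ _ m2 m1 (fun x y => f y x)).
  exact: measurable_swapped.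
by have /(integrable21ltyP _ _ mf) := fi.
Qed.

Lemma Rintegral_swap f :
  (m1 \x m2)%E.-integrable [set: X * Y] (fun z => (f z.1 z.2)%:E) ->
  \int[m1]_x \int[m2]_y f x y = \int[m2]_y \int[m1]_x f x y.
Proof.
move=> fi; rewrite Rintegral12//.
rewrite (@Rintegral12 _ _ _ _ _ m2 m1 (fun x y => f y x)); last first.
  exact: integrable_swapped.
rewrite /Rintegral; congr fine.
rewrite -(integral21_prod_meas1 fi).
by rewrite -(integral12_prod_meas1 (integrable_swapped fi)).
Qed.

End real_fubini_swap.

Section plane. Context {R:realType}.
Local Notation mu := (@lebesgue_measure R).
Local Notation RR := (measurableTypeR R).

(** Lebesgue measure on the plane, under a name of its own so that it carries
    the structure of a sigma-finite measure, which Fubini's theorem on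
    (R x R) x R requires. *)
Definition plane_measure : set (RR * RR) -> \bar R := (mu \x mu)%E.

HB.instance Definition _ := Measure.on plane_measure.

Lemma plane_measure_sigma_finite : sigma_finite [set: RR * RR] plane_measure.
Proof.
have /sigma_finiteP[F [FT Fnd Foo]] := sigma_finiteT mu.
exists (fun n => F n `*` F n); last first.
  move=> n; have [mF Fn] := Foo n; split; first exact: measurableX.
  by rewrite /plane_measure product_measure1E// lte_mul_pinfty// ge0_fin_numE.
apply/esym; rewrite -subTset => -[x y] _.
have [i _ Fx] : (\bigcup_i F i) x by rewrite -FT.
have [j _ Fy] : (\bigcup_i F i) y by rewrite -FT.
exists (maxn i j) => //; split => /=.
  by have /subsetPset := Fnd _ _ (leq_maxl i j); apply.
by have /subsetPset := Fnd _ _ (leq_maxr i j); apply.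
Qed.

HB.instance Definition _ :=
  @Measure_isSigmaFinite.Build _ _ _ plane_measure plane_measure_sigma_finite.
End plane.

(** * Cauchy-Schwarz and Young inequalities *)

Section weighted_inequalities.
Context {R : realType}.
Local Notation mu := (@lebesgue_measure R).
Local Notation RR := (measurableTypeR R).

Lemma measurable_fun_app2 d1 d2 d (X : measurableType d1) (Y : measurableType d2)
    (T : measurableType d) (f : X -> Y -> R) (p : T -> X) (q : T -> Y) :
  measurable_fun [set: X * Y] (fun z => f z.1 z.2) ->
  measurable_fun [set: T] p -> measurable_fun [set: T] q ->
  measurable_fun [set: T] (fun t => f (p t) (q t)).
Proof.
move=> mf mp mq.
exact: (measurableT_comp mf (measurable_fun_pair mp mq)).
Qed.

Lemma measurable_sub2 : measurable_fun [set: RR * RR] (fun z => (z.1 - z.2 : R)).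
Proof. exact: (measurable_funB measurable_fst measurable_snd). Qed.

Lemma measurable_add2 : measurable_fun [set: RR * RR] (fun z => (z.1 + z.2 : R)).
Proof. exact: (measurable_funD measurable_fst measurable_snd). Qed.

(** Cauchy-Schwarz for the measure with density p, obtained by integrating
    2 a(x) a(y) <= a(x)^2 + a(y)^2 against p(x) p(y); the integrals may be
    infinite. *)
Lemma cauchy_schwarz_weight d (X : measurableType d)
    (m : {sigma_finite_measure set X -> \bar R}) (a p : X -> R) :
  measurable_fun [set: X] a -> measurable_fun [set: X] p ->
  (forall x, 0 <= a x) -> (forall x, 0 <= p x) ->
  (\int[m]_x (a x * p x)%:E * \int[m]_x (a x * p x)%:E <=
   \int[m]_x (p x)%:E * \int[m]_x (a x ^+ 2 * p x)%:E)%E.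
Proof.
move=> ma mp a0 p0.
have map : measurable_fun [set: X] (EFin \o (fun x => a x * p x)).
  by apply/measurable_EFinP; exact: measurable_funM.
have maap : measurable_fun [set: X] (EFin \o (fun x => a x ^+ 2 * p x)).
  by apply/measurable_EFinP; apply: measurable_funM => //; exact: measurable_funX.
have mEp : measurable_fun [set: X] (EFin \o p) by exact/measurable_EFinP.
set I := (\int[m]_x (a x * p x)%:E)%E.
set P := (\int[m]_x (p x)%:E)%E.
set A := (\int[m]_x (a x ^+ 2 * p x)%:E)%E.
have I0 : (0 <= I)%E by apply: integral_ge0 => x _; rewrite lee_fin mulr_ge0.
have P0 : (0 <= P)%E by apply: integral_ge0 => x _; rewrite lee_fin.
have A0 : (0 <= A)%E.
  by apply: integral_ge0 => x _; rewrite lee_fin mulr_ge0// sqr_ge0.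
have key x : ((a x * p x)%:E * I + (a x * p x)%:E * I <=
    (a x ^+ 2 * p x)%:E * P + (p x)%:E * A)%E.
  rewrite -!ge0_integralZl_EFin//; try by move=> y _; rewrite lee_fin ?mulr_ge0// ?sqr_ge0.
  all: rewrite ?mulr_ge0// ?sqr_ge0//.
  rewrite -!ge0_integralD//; try by move=> y _; rewrite mule_ge0// lee_fin ?mulr_ge0// ?sqr_ge0.
  all: try exact: measurable_funeM.
  apply: ge0_le_integral => //.
  - by move=> y _; rewrite adde_ge0// mule_ge0// lee_fin ?mulr_ge0// ?sqr_ge0.
  - by apply: emeasurable_funD; exact: measurable_funeM.
  - by apply: emeasurable_funD; exact: measurable_funeM.
  move=> y _; rewrite -!EFinM -!EFinD lee_fin.
  have -> : a x ^+ 2 * p x * p y + p x * (a y ^+ 2 * p y) =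
    a x * p x * (a y * p y) + a x * p x * (a y * p y) + (a x - a y) ^+ 2 * (p x * p y).
    by ring.
  by rewrite lerDl mulr_ge0 ?sqr_ge0// mulr_ge0.
have H : (I * I + I * I <= P * A + P * A)%E.
  rewrite [X in (_ <= X + _)%E]muleC {1 3}/I {1}/A {2}/P.
  rewrite -!ge0_integralZr//; try by move=> y _; rewrite lee_fin ?mulr_ge0// ?sqr_ge0.
  rewrite -!ge0_integralD//; try by move=> y _; rewrite mule_ge0// lee_fin ?mulr_ge0// ?sqr_ge0.
  all: try exact: emeasurable_funM.
  apply: ge0_le_integral => //.
  - by move=> y _; rewrite adde_ge0// mule_ge0// lee_fin ?mulr_ge0// ?sqr_ge0.
  - by apply: emeasurable_funD; exact: emeasurable_funM.
  - by apply: emeasurable_funD; exact: emeasurable_funM.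
rewrite -(@lee_pmul2l _ 2%:E)// !mule_natl !mule2n//.
Qed.

(** Young's inequality between L^1 and L^2, for nonnegative functions and in
    squared form. *)
Lemma young (a N : R -> R) :
  measurable_fun [set: RR] a -> measurable_fun [set: RR] N ->
  (forall x, 0 <= a x) -> (forall x, 0 <= N x) ->
  (\int[mu]_x (\int[mu]_y (a y * N (x - y)%R)%:E * \int[mu]_y (a y * N (x - y)%R)%:E) <=
   \int[mu]_x (N x)%:E * (\int[mu]_x (N x)%:E * \int[mu]_x (a x ^+ 2)%:E))%E.
Proof.
move=> ma mN a0 N0.
set q := (\int[mu]_x (N x)%:E)%E.
have q0 : (0 <= q)%E by apply: integral_ge0 => x _; rewrite lee_fin.
have mNr x : measurable_fun [set: RR] (fun y => N (x - y)).
  exact: (measurableT_comp mN (measurable_reflection x)).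
have mNs : measurable_fun [set: RR * RR] (fun z => N (z.1 - z.2)).
  exact: (measurableT_comp mN measurable_sub2).
have mE (e : R -> R) : measurable_fun [set: RR] e -> (forall x, 0 <= e x) ->
    measurable_fun [set: RR] (fun x => \int[mu]_y (e y * N (x - y)%R)%:E)%E.
  move=> me e0.
  apply: (@measurable_fun_fubini_tonelli_F _ _ _ _ _ mu (fun z : RR * RR => (e z.2 * N (z.1 - z.2))%:E)) => //.
    apply/measurable_EFinP; apply: measurable_funM => //.
    exact: (measurableT_comp me measurable_snd).
  by move=> z; rewrite lee_fin mulr_ge0.
have ma2 : measurable_fun [set: RR] (fun y => a y ^+ 2) by exact: measurable_funX.
have a20 y : 0 <= a y ^+ 2 by exact: sqr_ge0.
have H : (\int[mu]_x (\int[mu]_y (a y * N (x - y)%R)%:E * \int[mu]_y (a y * N (x - y)%R)%:E) <=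
  \int[mu]_x (q * \int[mu]_y (a y ^+ 2 * N (x - y)%R)%:E))%E.
  apply: ge0_le_integral => //.
  - by move=> x _; apply: mule_ge0; apply: integral_ge0 => y _; rewrite lee_fin mulr_ge0.
  - by apply: emeasurable_funM; exact: mE.
  - by apply: measurable_funeM; exact: mE.
  move=> x _; rewrite /q -(integral_reflection (f := EFin \o N) x); last exact/measurable_EFinP.
  exact: (cauchy_schwarz_weight mu ma (mNr x)).
apply: (le_trans H); rewrite ge0_integralZl//; last 2 first.
- exact: mE.
- by move=> x _; apply: integral_ge0 => y _; rewrite lee_fin mulr_ge0.
apply: lee_wpmul2l => //.
rewrite (@fubini_tonelli _ _ _ _ _ mu mu (fun z : RR * RR => (a z.2 ^+ 2 * N (z.1 - z.2))%:E))//; last 2 first.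
- apply/measurable_EFinP; apply: measurable_funM => //.
  exact: (measurableT_comp ma2 measurable_snd).
- by move=> z; rewrite lee_fin mulr_ge0.
rewrite -ge0_integralZl//; last 2 first.
- exact/measurable_EFinP.
- by move=> x _; rewrite lee_fin.
rewrite le_eqVlt; apply/orP; left; apply/eqP; apply: eq_integral => y _ /=.
under eq_integral do rewrite EFinM.
rewrite ge0_integralZl_EFin//; last 2 first.
- by move=> x _; rewrite lee_fin.
- apply/measurable_EFinP; exact: (measurableT_comp mN (measurable_translation (- y))).
by rewrite (@integral_translation _ (- y) (EFin \o N)) 1?muleC//; exact/measurable_EFinP.
Qed.

End weighted_inequalities.

(** * Primitives in time *)

Lemma abse_Rintegral_le d (X : measurableType d) (R : realType)
    (m : {measure set X -> \bar R}) (f : X -> R) :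
  measurable_fun [set: X] f ->
  (`|\int[m]_x f x|%:E <= \int[m]_x `|f x|%:E)%E.
Proof.
move=> mf; have mEf : measurable_fun [set: X] (EFin \o f) by exact/measurable_EFinP.
exact: le_trans (abse_fine_le _) (le_abse_integral m measurableT mEf).
Qed.

Lemma EFin_Rintegral d (X : measurableType d) (R : realType)
    (m : {measure set X -> \bar R}) (f : X -> R) :
  m.-integrable [set: X] (EFin \o f) ->
  (\int[m]_x f x)%:E = (\int[m]_x (f x)%:E)%E.
Proof. by move=> fi; rewrite fineK//; exact: integrable_fin_num. Qed.

Lemma integrable_dominated d (X : measurableType d) (R : realType)
    (m : {measure set X -> \bar R}) (f g : X -> R) :
  measurable_fun [set: X] f -> (forall x, `|f x| <= g x) ->
  m.-integrable [set: X] (EFin \o g) -> m.-integrable [set: X] (EFin \o f).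
Proof.
move=> mf fg; apply: le_integrable => //; first exact/measurable_EFinP.
by move=> x _ /=; rewrite lee_fin (le_trans (fg x))// ler_norm.
Qed.

Lemma integrable_tensor d1 d2 (X : measurableType d1) (Y : measurableType d2)
    (R : realType) (m1 : {sigma_finite_measure set X -> \bar R})
    (m2 : {sigma_finite_measure set Y -> \bar R}) (c : X -> R) (e : Y -> R) :
  m1.-integrable [set: X] (EFin \o c) -> m2.-integrable [set: Y] (EFin \o e) ->
  (m1 \x m2)%E.-integrable [set: X * Y] (fun z => (c z.1 * e z.2)%:E).
Proof.
move=> /integrableP[/measurable_EFinP mc cfin] /integrableP[/measurable_EFinP me efin].
have mce : measurable_fun [set: X * Y] (fun z => c z.1 * e z.2).
  by apply: measurable_funM;
    [exact: (measurableT_comp mc measurable_fst)|exact: (measurableT_comp me measurable_snd)].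
apply: (integrable_prod (f := fun x y => c x * e y)) => //.
under eq_integral => x _.
  under eq_integral => y _ do rewrite normrM EFinM.
  rewrite ge0_integralZl_EFin//; last by apply/measurable_EFinP; exact: measurableT_comp.
  over.
rewrite ge0_integralZr//; last 2 first.
- by apply/measurable_EFinP; exact: measurableT_comp.
- exact: integral_ge0.
apply: lte_mul_pinfty => //; first exact: integral_ge0.
by rewrite ge0_fin_numE//; exact: integral_ge0.
Qed.

Section heaviside.
Context {R : realType}.
Local Notation mu := (@lebesgue_measure R).
Local Notation RR := (measurableTypeR R).

(** The Heaviside function, with value 1 at 0, so that s is in ]-oo, t] exactly
    when heaviside (t - s) = 1. *)
Definition heaviside (t : R) : R := \1_`[0, +oo[ t.

Lemma heavisideE t : heaviside t = (0 <= t)%R%:R.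
Proof. by rewrite /heaviside indicE mem_setE in_itv /= andbT. Qed.

Lemma heaviside_norm t : `|heaviside t| <= 1.
Proof. by rewrite heavisideE; case: (0 <= t); rewrite ?normr1 ?normr0. Qed.

Lemma measurable_heaviside : measurable_fun [set: RR] heaviside.
Proof. exact: measurable_indic. Qed.

Lemma measurable_heaviside_sub (t : R) :
  measurable_fun [set: RR] (fun s => heaviside (t - s)).
Proof. exact: (measurableT_comp measurable_heaviside (measurable_reflection t)). Qed.

Lemma integrable_heaviside (t : R) (a : R -> R) :
  mu.-integrable [set: RR] (EFin \o a) ->
  mu.-integrable [set: RR] (EFin \o (fun s => heaviside (t - s) * a s)).
Proof.
move=> ia; have ma : measurable_fun [set: RR] a.
  by apply/measurable_EFinP; exact: (measurable_int _ ia).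
apply: (integrable_dominated (X := RR) (g := fun s => `|a s|)).
- by apply: measurable_funM => //; exact: measurable_heaviside_sub.
- by move=> s; rewrite normrM ler_piMl// heaviside_norm.
- exact: integrable_norm.
Qed.

(** The product rule for the primitives of a and b, integrated over time.  The
    two terms integrate a(s) b(t) over the half-planes s <= t and t <= s, which
    cover the plane and overlap in a null set. *)
Lemma primitive_product (a b : R -> R) :
  mu.-integrable [set: RR] (EFin \o a) -> mu.-integrable [set: RR] (EFin \o b) ->
  \int[mu]_t ((\int[mu]_s (heaviside (t - s) * a s)) * b t) +
  \int[mu]_t ((\int[mu]_s (heaviside (t - s) * b s)) * a t) =
  (\int[mu]_s a s) * (\int[mu]_s b s).
Proof.
move=> ia ib.
have ma : measurable_fun [set: RR] a.
  by apply/measurable_EFinP; exact: (measurable_int _ ia).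
have mb : measurable_fun [set: RR] b.
  by apply/measurable_EFinP; exact: (measurable_int _ ib).
have prod_int (c d : R -> R) (e : R -> R -> R) :
    mu.-integrable [set: RR] (EFin \o c) -> mu.-integrable [set: RR] (EFin \o d) ->
    measurable_fun [set: RR * RR] (fun z => e z.1 z.2) ->
    (forall x y, `|e x y| <= 1) ->
  (mu \x mu)%E.-integrable [set: RR * RR] (fun z => (e z.1 z.2 * c z.2 * d z.1)%:E).
  move=> ic id me e1; have icd := integrable_tensor id ic.
  have mcd : measurable_fun [set: RR * RR] (fun z => d z.1 * c z.2).
    by apply/measurable_EFinP; exact: (measurable_int _ icd).
  apply: (integrable_dominated (g := fun z : RR * RR => `|d z.1 * c z.2|)).
  - rewrite (_ : (fun _ => _) = fun z => e z.1 z.2 * (d z.1 * c z.2)).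
      exact: measurable_funM.
    by apply/funext => z; ring.
  - move=> z; rewrite -mulrA (mulrC (c _)) normrM ler_piMl//.
  - exact: integrable_norm.
have mh1 : measurable_fun [set: RR * RR] (fun z => heaviside (z.1 - z.2)).
  exact: (measurableT_comp measurable_heaviside measurable_sub2).
have mh2 : measurable_fun [set: RR * RR] (fun z => heaviside (z.2 - z.1)).
  exact: (@measurable_swapped _ _ RR RR R (fun x y => heaviside (x - y))).
have I1 := prod_int a b (fun x y => heaviside (x - y)) ia ib mh1 (fun x y => heaviside_norm _).
have I2 := prod_int b a (fun x y => heaviside (x - y)) ib ia mh1 (fun x y => heaviside_norm _).
have I3 := prod_int a b (fun x y => heaviside (y - x)) ia ib mh2 (fun x y => heaviside_norm _).
have -> : \int[mu]_t ((\int[mu]_s (heaviside (t - s) * b s)) * a t) =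
    \int[mu]_t ((\int[mu]_s (heaviside (s - t) * a s)) * b t).
  transitivity (\int[mu]_t \int[mu]_s (heaviside (t - s) * b s * a t)).
    apply: eq_Rintegral => t _; rewrite RintegralZr//.
    exact: integrable_heaviside.
  rewrite (Rintegral_swap (X := RR) (Y := RR) (f := fun t s => heaviside (t - s) * b s * a t))//.
  apply: eq_Rintegral => s _; rewrite -RintegralZr//.
    by apply: eq_Rintegral => t _; rewrite mulrAC.
  apply: (integrable_dominated (X := RR) (g := fun s => `|a s|)).
  - apply: measurable_funM => //; apply: (measurableT_comp measurable_heaviside).
    exact: measurable_translation.
  - by move=> t; rewrite normrM ler_piMl// heaviside_norm.
  - exact: integrable_norm.
have ih2 t : mu.-integrable [set: RR] (EFin \o (fun s => heaviside (s - t) * a s)).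
  apply: (integrable_dominated (X := RR) (g := fun s => `|a s|)).
  - apply: measurable_funM => //; apply: (measurableT_comp measurable_heaviside).
    exact: measurable_translation.
  - by move=> s; rewrite normrM ler_piMl// heaviside_norm.
  - exact: integrable_norm.
have J1 : mu.-integrable [set: RR] (EFin \o (fun t => (\int[mu]_s (heaviside (t - s) * a s)) * b t)).
  have := integrable_Rintegral (X := RR) (Y := RR) (f := fun x y => heaviside (x - y) * a y * b x) I1.
  apply: eq_integrable => // t _ /=; rewrite RintegralZr//.
  exact: integrable_heaviside.
have J2 : mu.-integrable [set: RR] (EFin \o (fun t => (\int[mu]_s (heaviside (s - t) * a s)) * b t)).
  have := integrable_Rintegral (X := RR) (Y := RR) (f := fun x y => heaviside (y - x) * a y * b x) I3.
  apply: eq_integrable => // t _ /=; rewrite RintegralZr//.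
rewrite -RintegralD//.
rewrite -RintegralZl//; apply: eq_Rintegral => t _.
rewrite -mulrDl; congr (_ * _).
rewrite -RintegralD//; last exact: integrable_heaviside.
rewrite /Rintegral; congr fine; apply: ae_eq_integral => //.
- apply/measurable_EFinP; apply: measurable_funD.
    by apply: measurable_funM => //; exact: measurable_heaviside_sub.
  by apply/measurable_EFinP; exact: (measurable_int _ (ih2 t)).
- exact: (measurable_int _ ia).
(* the two Heaviside factors add up to 1 except at s = t *)
- exists [set t]; split => //; first exact: lebesgue_measure_set1.
  move=> s /= H; apply: contrapT => st; apply: H => _.
  rewrite !heavisideE -mulrDl !subr_ge0.
  case: (ltgtP s t) => [_|_|//]; by rewrite ?addr0 ?add0r mul1r.
Qed.

End heaviside.

(** * Convolution *)

Section convolution.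
Context {R : realType}.
Local Notation mu := (@lebesgue_measure R).
Local Notation RR := (measurableTypeR R).

(** The convolution of f with zeta at x. *)
Definition convolution (zeta f : R -> R) (x : R) : R :=
  \int[mu]_y (f y * zeta (x - y)).

Variable zeta : R -> R.
Hypothesis zeta_int : mu.-integrable [set: RR] (EFin \o zeta).

Let mzeta : measurable_fun [set: RR] zeta.
Proof. by apply/measurable_EFinP; exact: (measurable_int _ zeta_int). Qed.

Lemma measurable_convolution_integrand d (X : measurableType d)
    (f : X -> R -> R) (p : X -> RR) :
  measurable_fun [set: X * RR] (fun z => f z.1 z.2) ->
  measurable_fun [set: X] p ->
  measurable_fun [set: X * RR] (fun z => f z.1 z.2 * zeta (p z.1 - z.2)).
Proof.
move=> mf mp; apply: measurable_funM => //; apply: (measurableT_comp mzeta).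
by apply: measurable_funB => //; exact: (measurableT_comp mp measurable_fst).
Qed.

Lemma measurable_convolution d (X : measurableType d)
    (f : X -> R -> R) (p : X -> RR) :
  measurable_fun [set: X * RR] (fun z => f z.1 z.2) ->
  measurable_fun [set: X] p ->
  measurable_fun [set: X] (fun z => convolution zeta (f z) (p z)).
Proof.
move=> mf mp.
apply: (measurable_Rintegral (Y := RR) mu (f := fun z y => f z y * zeta (p z - y))).
exact: measurable_convolution_integrand.
Qed.

Lemma integrable_convolution_integrand (f : R -> R) (c x : R) :
  measurable_fun [set: RR] f -> (forall y, `|f y| <= c) ->
  mu.-integrable [set: RR] (EFin \o (fun y => f y * zeta (x - y))).
Proof.
move=> mf fc.
have ic : mu.-integrable [set: RR] (EFin \o (fun y => c * `|zeta (x - y)|)).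
  have := integrable_reflection x (integrable_norm zeta_int).
  by move/(integrableZl measurableT c); apply: eq_integrable.
apply: (integrable_dominated (X := RR) (g := fun y => c * `|zeta (x - y)|)) => //.
- by apply: measurable_funM => //; exact: (measurableT_comp mzeta (measurable_reflection x)).
- by move=> y; rewrite normrM ler_wpM2r.
Qed.

Lemma convolution_bounded (f : R -> R) (x : R) :
  measurable_fun [set: RR] f -> (forall y, `|f y| <= 1) ->
  `|convolution zeta f x| <= \int[mu]_y `|zeta y|.
Proof.
move=> mf f1.
have iz := integrable_reflection x (integrable_norm zeta_int).
rewrite -(Rintegral_reflection x); last exact: measurableT_comp.
apply: le_trans (le_normr_Rintegral _ (integrable_convolution_integrand _ mf f1)) _ => //.
apply: le_Rintegral => //.
- have := integrable_norm (integrable_convolution_integrand x mf f1).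
  exact: eq_integrable.
- by move=> y _; rewrite normrM ler_piMl.
Qed.

(** Young's inequality for a kernel of any sign. *)
Lemma convolution_L2 (f : R -> R) :
  measurable_fun [set: RR] f ->
  (\int[mu]_x (convolution zeta f x ^+ 2)%:E <=
   \int[mu]_x `|zeta x|%:E * (\int[mu]_x `|zeta x|%:E * \int[mu]_x (f x ^+ 2)%:E))%E.
Proof.
move=> mf.
have mnz : measurable_fun [set: RR] (fun x => `|zeta x|) by exact: measurableT_comp.
have mnf : measurable_fun [set: RR] (fun x => `|f x|) by exact: measurableT_comp.
have mf2 : measurable_fun [set: RR * RR] (fun z => f z.2).
  exact: (measurableT_comp mf measurable_snd).
have mc : measurable_fun [set: RR] (convolution zeta f).
  exact: (@measurable_convolution _ RR (fun _ => f) id).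
have -> : (\int[mu]_x (f x ^+ 2)%:E = \int[mu]_x (`|f x| ^+ 2)%:E)%E.
  by apply: eq_integral => x _; rewrite real_normK// num_real.
apply: le_trans (young mnf mnz (fun x => normr_ge0 _) (fun x => normr_ge0 _)).
have mI : measurable_fun [set: RR] (fun x => \int[mu]_y (`|f y| * `|zeta (x - y)%R|)%:E)%E.
  apply: (@measurable_fun_fubini_tonelli_F _ _ RR RR _ mu
    (fun z => (`|f z.2| * `|zeta (z.1 - z.2)|)%:E)).
    apply/measurable_EFinP; apply: measurable_funM.
      exact: (measurableT_comp mnf measurable_snd).
    exact: (measurableT_comp mnz measurable_sub2).
  by move=> z; rewrite lee_fin mulr_ge0.
apply: ge0_le_integral => //.
- by move=> x _; rewrite lee_fin sqr_ge0.
- by apply/measurable_EFinP; exact: measurable_funX.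
- exact: emeasurable_funM.
move=> x _.
have H : (`|convolution zeta f x|%:E <= \int[mu]_y (`|f y| * `|zeta (x - y)%R|)%:E)%E.
  apply: le_trans (abse_Rintegral_le _ _) _.
    apply: measurable_funM => //.
    exact: (measurableT_comp mzeta (measurable_reflection x)).
  by under eq_integral do rewrite normrM.
by rewrite -real_normK ?num_real// expr2 EFinM; apply: lee_pmul => //; rewrite lee_fin.
Qed.

End convolution.

(** * Functions supported in a time interval *)

Section time_support.
Context {R : realType}.
Local Notation mu := (@lebesgue_measure R).
Local Notation RR := (measurableTypeR R).
Variable T : R.

Lemma integrable_indic_itvR (a b : R) :
  mu.-integrable [set: RR] (EFin \o (\1_`[a, b] : R -> R)).
Proof. exact: (integrable_indic_itv a b true false). Qed.

Lemma bounded_by_indic (f : R -> R) (c : R) :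
  (forall t, `|f t| <= c) -> (forall t, ~~ (0 <= t <= T) -> f t = 0) ->
  forall t, `|f t| <= c * \1_`[0, T] t.
Proof.
move=> fc f0 t; rewrite indicE mem_setE in_itv /=.
by case: (boolP (0 <= t <= T)) => [_|/f0 ->]; rewrite ?mulr1 ?normr0 ?mulr0.
Qed.

Lemma integrable_supported (f : R -> R) (c : R) : measurable_fun [set: RR] f ->
  (forall t, `|f t| <= c) -> (forall t, ~~ (0 <= t <= T) -> f t = 0) ->
  mu.-integrable [set: RR] (EFin \o f).
Proof.
move=> mf fc f0.
apply: (integrable_dominated (X := RR) (g := fun t => c * \1_`[0, T] t)) => //.
  exact: bounded_by_indic.
have := integrable_indic_itvR 0 T; move/(integrableZl measurableT c).
exact: eq_integrable.
Qed.

(** Cauchy-Schwarz in time: over a bounded time interval, the time integral of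
    a square integrable function is square integrable in space. *)
Lemma time_integral_L2 (f : R -> R -> R) (c : R) : 0 <= T ->
  measurable_fun [set: RR * RR] (fun z => f z.1 z.2) ->
  (forall t x, `|f t x| <= c) ->
  (forall t x, ~~ (0 <= t <= T) -> f t x = 0) ->
  (\int[mu]_t \int[mu]_x (f t x ^+ 2)%:E < +oo)%E ->
  mu.-integrable [set: RR] (EFin \o (fun x => (\int[mu]_t `|f t x|) ^+ 2)).
Proof.
move=> T0 mf fc f0 f2.
have mfx x : measurable_fun [set: RR] (fun t => f t x).
  exact: (measurableT_comp mf (measurable_pair2 x)).
have mnf : measurable_fun [set: RR * RR] (fun z => `|f z.2 z.1|).
  by apply: (@measurable_swapped _ _ RR RR R (fun x y => `|f x y|)); exact: measurableT_comp.
have mA : measurable_fun [set: RR] (fun x => \int[mu]_t `|f t x|).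
  exact: (measurable_Rintegral (X := RR) (Y := RR) mu (f := fun x t => `|f t x|)).
have fi x : mu.-integrable [set: RR] (EFin \o (fun t => `|f t x|)).
  apply: (@integrable_supported _ c).
  - by apply: measurableT_comp => //; exact: mfx.
  - by move=> t; rewrite normr_id.
  - by move=> t /f0 ->; rewrite normr0.
apply/integrableP; split; first by apply/measurable_EFinP; exact: measurable_funX.
apply: (@le_lt_trans _ _ (T%:E * \int[mu]_t \int[mu]_x (f t x ^+ 2)%:E)%E); last first.
  apply: lte_mul_pinfty => //.
rewrite (@fubini_tonelli _ _ RR RR _ mu mu (fun z => (f z.1 z.2 ^+ 2)%:E)); last 2 first.
- by apply/measurable_EFinP; exact: measurable_funX.
- by move=> z; rewrite lee_fin sqr_ge0.
have mf2 : measurable_fun [set: RR] (fun x => \int[mu]_t (f t x ^+ 2)%:E)%E.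
  apply: (@measurable_fun_fubini_tonelli_G _ _ RR RR _ mu (fun z => (f z.1 z.2 ^+ 2)%:E)).
  - by apply/measurable_EFinP; exact: measurable_funX.
  - by move=> z; rewrite lee_fin sqr_ge0.
rewrite -ge0_integralZl//; last first.
  by move=> x _; apply: integral_ge0 => t _; rewrite lee_fin sqr_ge0.
apply: ge0_le_integral => //.
- by apply: measurableT_comp => //; apply/measurable_EFinP; exact: measurable_funX.
- by apply: measurable_funeM.
move=> x _ /=; rewrite ger0_norm ?sqr_ge0// expr2 EFinM EFin_Rintegral//.
have ind0 t : 0 <= (\1_`[0, T] : R -> R) t by rewrite indicE.
have /= := @cauchy_schwarz_weight R _ RR mu (fun t => `|f t x|) \1_`[0, T]
  (measurableT_comp (@normr_measurable R setT) (mfx x)) (measurable_indic (measurable_itv _))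
  (fun t => normr_ge0 _) ind0.
have fE t : `|f t x| * \1_`[0, T] t = `|f t x|.
  rewrite indicE mem_setE in_itv /=.
  by case: (boolP (0 <= t <= T)) => [_|/f0 ->]; rewrite ?mulr1 ?normr0 ?mul0r.
under eq_integral do rewrite fE.
under [in X in (_ <= _ * X)%E]eq_integral do rewrite expr2 -mulrA fE -expr2 real_normK ?num_real//.
have -> // : (\int[mu]_t (\1_`[0, T] t)%:E = T%:E)%E.
have -> : (\int[mu]_t (\1_`[0, T] t)%:E = mu `[0%R, T])%E by rewrite integral_indic// setIT.
rewrite lebesgue_measure_itv/= lte_fin; case: ltP => [_|T0']; first by rewrite -EFinB subr0.
by rewrite (_ : T = 0)//; apply/le_anti/andP.
Qed.

End time_support.

(** * The primitive in time of a mollified function *)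

Section convolution_in_time.
Context {R : realType}.
Local Notation mu := (@lebesgue_measure R).
Local Notation RR := (measurableTypeR R).
Variables (T : R) (W : R -> R -> R) (zeta : R -> R).
Hypothesis T_ge0 : 0 <= T.
Hypothesis W_meas : measurable_fun [set: RR * RR] (fun z => W z.1 z.2).
Hypothesis W_le1 : forall t x, `|W t x| <= 1.
Hypothesis W_supp : forall t x, ~~ (0 <= t <= T) -> W t x = 0.
Hypothesis W_L2 : (\int[mu]_t \int[mu]_x (W t x ^+ 2)%:E < +oo)%E.
Hypothesis zeta_int : mu.-integrable [set: RR] (EFin \o zeta).

Let mzeta : measurable_fun [set: RR] zeta.
Proof. by apply/measurable_EFinP; exact: (measurable_int _ zeta_int). Qed.

Let mW t : measurable_fun [set: RR] (W t).
Proof. exact: (measurableT_comp W_meas (measurable_pair1 t)). Qed.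

Lemma convolution_time_le t x : `|convolution zeta (W t) x| <= \int[mu]_y `|zeta y|.
Proof. exact: convolution_bounded. Qed.

Lemma convolution_time_supp t x :
  ~~ (0 <= t <= T) -> convolution zeta (W t) x = 0.
Proof.
move=> tT; rewrite /convolution.
under eq_Rintegral do rewrite W_supp// mul0r.
by rewrite /Rintegral integral0.
Qed.

Lemma measurable_convolution_time :
  measurable_fun [set: RR * RR] (fun z => convolution zeta (W z.1) z.2).
Proof.
apply: (measurable_convolution (X := (RR * RR)%type) zeta_int
  (f := fun z y => W z.1 y) (p := snd)); last exact: measurable_snd.
apply: (measurable_fun_app2 (X := RR) (Y := RR) W_meas); last exact: measurable_snd.
exact: (measurableT_comp measurable_fst measurable_fst).
Qed.

Let intnz_fin : (\int[mu]_x `|zeta x|%:E)%E \is a fin_num.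
Proof. exact: integrable_fin_num (integrable_norm zeta_int). Qed.

Lemma convolution_time_L2 :
  (\int[mu]_t \int[mu]_x (convolution zeta (W t) x ^+ 2)%:E <=
   \int[mu]_x `|zeta x|%:E * (\int[mu]_x `|zeta x|%:E *
    \int[mu]_t \int[mu]_x (W t x ^+ 2)%:E))%E.
Proof.
have mI (f : R -> R -> R) : measurable_fun [set: RR * RR] (fun z => f z.1 z.2) ->
    measurable_fun [set: RR] (fun t => \int[mu]_x (f t x ^+ 2)%:E)%E.
  move=> mf; apply: (@measurable_fun_fubini_tonelli_F _ _ RR RR _ mu (fun z => (f z.1 z.2 ^+ 2)%:E)).
  - by apply/measurable_EFinP; exact: measurable_funX.
  - by move=> z; rewrite lee_fin sqr_ge0.
have I0 (f : R -> R -> R) t : (0 <= \int[mu]_x (f t x ^+ 2)%:E)%E.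
  by apply: integral_ge0 => x _; rewrite lee_fin sqr_ge0.
have q0 : (0 <= \int[mu]_x `|zeta x|%:E)%E by exact: integral_ge0.
rewrite -[X in (_ <= _ * X)%E]ge0_integralZl//; last exact: mI.
rewrite -[leRHS]ge0_integralZl//; last 2 first.
- by apply: measurable_funeM; exact: mI.
- by move=> t _; exact: mule_ge0.
apply: ge0_le_integral => //.
- by move=> t _; exact: (I0 (fun t x => convolution zeta (W t) x)).
- exact: (mI (fun t x => convolution zeta (W t) x) measurable_convolution_time).
- by apply: measurable_funeM; apply: measurable_funeM; exact: mI.
move=> t _; exact: convolution_L2.
Qed.

Lemma convolution_time_L2_fin :
  (\int[mu]_t \int[mu]_x (convolution zeta (W t) x ^+ 2)%:E < +oo)%E.
Proof.
apply: (le_lt_trans convolution_time_L2).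
apply: lte_mul_pinfty => //; first exact: integral_ge0.
by apply: lte_mul_pinfty => //; exact: integral_ge0.
Qed.

End convolution_in_time.

Section primitive_in_time.
Context {R : realType}.
Local Notation mu := (@lebesgue_measure R).
Local Notation RR := (measurableTypeR R).
Variables (T Z : R) (Om : R -> R -> R).
Hypothesis T_ge0 : 0 <= T.
Hypothesis mOm : measurable_fun [set: RR * RR] (fun z => Om z.1 z.2).
Hypothesis Om_le : forall t x, `|Om t x| <= Z.
Hypothesis Om_supp : forall t x, ~~ (0 <= t <= T) -> Om t x = 0.
Hypothesis Om_L2 : (\int[mu]_t \int[mu]_x (Om t x ^+ 2)%:E < +oo)%E.

(** The primitive in time F_t(x) = int_0^t Om_s(x) ds of a function that vanishes
    for negative times; the Heaviside factor makes the integrand jointly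
    measurable in (t, s, x). *)
Definition primitive (t x : R) : R := \int[mu]_s (heaviside (t - s) * Om s x).

Local Notation F := primitive.
Let Hb (x : R) : R := \int[mu]_s `|Om s x|.

Let mOm1 x : measurable_fun [set: RR] (fun t => Om t x).
Proof. exact: (measurableT_comp mOm (measurable_pair2 x)). Qed.

Lemma integrable_in_time x : mu.-integrable [set: RR] (EFin \o (fun t => Om t x)).
Proof. by apply: (@integrable_supported R T _ Z) => // t; exact: Om_supp. Qed.
Let iOm := integrable_in_time.

Lemma integrable_sqr_time_space : (mu \x mu)%E.-integrable [set: RR * RR] (EFin \o (fun z => Om z.1 z.2 ^+ 2)).
Proof.
apply: (integrable_prod (X := RR) (Y := RR) (f := fun t x => Om t x ^+ 2)).
  exact: measurable_funX.
by under eq_integral do under eq_integral do rewrite ger0_norm ?sqr_ge0//.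
Qed.

Let iOmOm := integrable_sqr_time_space.

Let iHb2 : mu.-integrable [set: RR] (EFin \o (fun x => Hb x ^+ 2)).
Proof. exact: (time_integral_L2 T_ge0 mOm Om_le Om_supp Om_L2). Qed.

Lemma measurable_primitive : measurable_fun [set: RR * RR] (fun z => F z.1 z.2).
Proof.
apply: (measurable_Rintegral (X := (RR * RR)%type) (Y := RR) mu
  (f := fun z s => heaviside (z.1 - s) * Om s z.2)).
apply: measurable_funM.
  apply: (measurableT_comp measurable_heaviside).
  apply: measurable_funB; last exact: measurable_snd.
  exact: (measurableT_comp measurable_fst measurable_fst).
apply: (measurable_fun_app2 (X := RR) (Y := RR) mOm); first exact: measurable_snd.
exact: (measurableT_comp measurable_snd measurable_fst).
Qed.

Let mF := measurable_primitive.

Let F_le t x : `|F t x| <= Hb x.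
Proof.
apply: le_trans (le_normr_Rintegral _ (integrable_heaviside t (iOm x))) _ => //.
apply: le_Rintegral => //.
- exact: (integrable_norm (integrable_heaviside t (iOm x))).
- exact: (integrable_norm (iOm x)).
- by move=> s _; rewrite normrM ler_piMl// heaviside_norm.
Qed.

Let FOm_le t x y : `|F t x * Om t y| <= \1_`[0, T] t * Hb x ^+ 2 + Om t y ^+ 2.
Proof.
have [tT|tT] := boolP (0 <= t <= T); last first.
  rewrite Om_supp// mulr0 normr0 expr0n addr0 mulr_ge0 ?sqr_ge0//.
rewrite indicE mem_setE in_itv/= tT mul1r normrM.
have := F_le t x; have := normr_ge0 (F t x); have := normr_ge0 (Om t y).
rewrite -[Om t y ^+ 2]real_normK ?num_real//.
move: `|F t x| `|Om t y| (Hb x) => a b c b0 a0 ac.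
have : a * b <= c * b by exact: ler_wpM2r.
have := sqr_ge0 (c - b); have := sqr_ge0 (c + b).
nra.
Qed.

Lemma integrable_primitive_mul (a : R) :
  (mu \x mu)%E.-integrable [set: RR * RR] (fun z => (F z.1 (z.2 + a) * Om z.1 z.2)%:E).
Proof.
apply: (integrable_dominated (X := (RR * RR)%type)
  (f := fun z => F z.1 (z.2 + a) * Om z.1 z.2)
  (g := fun z => \1_`[0, T] z.1 * Hb (z.2 + a) ^+ 2 + Om z.1 z.2 ^+ 2)).
- apply: measurable_funM; last exact: mOm.
  apply: (measurable_fun_app2 (X := RR) (Y := RR) mF); first exact: measurable_fst.
  exact: (measurableT_comp (measurable_translation a) measurable_snd).
- by move=> z; exact: FOm_le.
- have := integrable_tensor (integrable_indic_itvR 0 T) (integrable_translation a iHb2).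
  by move/(integrableD measurableT)/(_ iOmOm); apply: eq_integrable.
Qed.

Let iFOm := integrable_primitive_mul.

(** The integral over time and space of F_t(x + a) Om_t(x). *)
Definition correlation (a : R) : R := \int[(mu \x mu)%E]_z (F z.1 (z.2 + a) * Om z.1 z.2).

Local Notation Em := correlation.

Let EmE a : Em a = \int[mu]_x \int[mu]_t (F t (x + a) * Om t x).
Proof.
rewrite -(Rintegral_swap (X := RR) (Y := RR) (f := fun t x => F t (x + a) * Om t x))//.
by rewrite (Rintegral12 (X := RR) (Y := RR) (f := fun t x => F t (x + a) * Om t x)).
Qed.

Let P (x : R) : R := \int[mu]_s Om s x.

Let iE a : mu.-integrable [set: RR] (EFin \o (fun x => \int[mu]_t (F t (x + a) * Om t x))).
Proof.
apply: (integrable_Rintegral (X := RR) (Y := RR) (f := fun x t => F t (x + a) * Om t x)).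
exact: (integrable_swapped (X := RR) (Y := RR) (f := fun t x => F t (x + a) * Om t x)).
Qed.

Let mP : measurable_fun [set: RR] P.
Proof.
apply: (measurable_Rintegral (X := RR) (Y := RR) mu (f := fun x s => Om s x)).
exact: (measurable_swapped mOm).
Qed.

Let P_le x : `|P x| <= Hb x.
Proof. by apply: le_normr_Rintegral => //; exact: iOm. Qed.

Let iP2 : mu.-integrable [set: RR] (EFin \o (fun x => P x ^+ 2)).
Proof.
apply: (integrable_dominated (X := RR) (g := fun x => Hb x ^+ 2)) => //.
  exact: measurable_funX.
by move=> x; rewrite normrX lerXn2r ?nnegrE ?normr_ge0// ?P_le// (le_trans _ (P_le x)).
Qed.

Let i2 h : mu.-integrable [set: RR] (EFin \o (fun x => \int[mu]_t (F t x * Om t (x + h)))).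
Proof.
have := integrable_translation h (iE (- h)).
apply: eq_integrable; first exact: measurableT.
move=> x _; congr EFin; apply: eq_Rintegral => t _; by rewrite addrK.
Qed.

Let EmN (h : R) : Em (- h) = \int[mu]_x \int[mu]_t (F t x * Om t (x + h)).
Proof.
rewrite EmE -(Rintegral_translation h (f := fun x => \int[mu]_t (F t (x - h) * Om t x))).
  apply: eq_Rintegral => x _; apply: eq_Rintegral => t _.
  by rewrite addrK.
by apply/measurable_EFinP; exact: (measurable_int _ (iE (- h))).
Qed.

Let EmD (h : R) : Em h + Em (- h) = \int[mu]_x (P (x + h) * P x).
Proof.
rewrite EmN EmE -(RintegralD measurableT (iE h) (i2 h)).
apply: eq_Rintegral => x _.
exact: (primitive_product (iOm (x + h)) (iOm x)).
Qed.

(** Pairing F_t(x + h) + F_t(x - h) - 2 F_t(x) with Om_t(x) gives the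
    integral of P(x + h) P(x) - P(x)^2, where P(x) is the total time integral
    of Om(x), and this is at most 0 by translation invariance. *)
Lemma correlation_le0 (h : R) : Em h + Em (- h) - 2 * Em 0 <= 0.
Proof.
have -> : 2 * Em 0 = \int[mu]_x (P x ^+ 2).
  rewrite (_ : 2 * Em 0 = Em 0 + Em (- 0)); last by rewrite oppr0; ring.
  rewrite EmD.
  by apply: eq_Rintegral => x _; rewrite addr0 expr2.
rewrite subr_le0 EmD.
have iPh := integrable_translation h iP2.
have -> : \int[mu]_x (P x ^+ 2) = \int[mu]_x (2^-1 * (P (x + h) ^+ 2 + P x ^+ 2)).
  rewrite RintegralZl//; last first.
    by have := integrableD measurableT iPh iP2; apply: eq_integrable.
  rewrite RintegralD//.
  rewrite (Rintegral_translation h (f := fun x => P x ^+ 2)); last exact: measurable_funX.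
  lra.
have mPP : measurable_fun [set: RR] (fun x => P (x + h) * P x).
  by apply: measurable_funM => //; exact: (measurableT_comp mP (measurable_translation h)).
have iD : mu.-integrable [set: RR] (EFin \o (fun x => 2^-1 * (P (x + h) ^+ 2 + P x ^+ 2))).
  have := integrableD measurableT iPh iP2.
  by move/(integrableZl measurableT 2^-1); apply: eq_integrable.
have PP x : `|P (x + h) * P x| <= 2^-1 * (P (x + h) ^+ 2 + P x ^+ 2).
  rewrite ler_norml; have := sqr_ge0 (P (x + h) - P x); have := sqr_ge0 (P (x + h) + P x).
  by nra.
apply: le_Rintegral => //.
- exact: (integrable_dominated (X := RR) mPP PP iD).
- by move=> x _; apply: le_trans (ler_norm _) (PP x).
Qed.

End primitive_in_time.

(** * The energy inequality *)

(** The centred second difference of zeta at u with step h, weighted by k(h). *)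
Definition second_difference (R : realType) (k zeta : R -> R) (u h : R) : R :=
  k h * (zeta (u + h) + zeta (u - h) - 2 * zeta u).

Section energy.
Context {R : realType}.
Local Notation mu := (@lebesgue_measure R).
Local Notation RR := (measurableTypeR R).
Variables (T Z : R) (W Om : R -> R -> R) (zeta k p : R -> R).
Hypothesis T_ge0 : 0 <= T.
Hypothesis mW : measurable_fun [set: RR * RR] (fun z => W z.1 z.2).
Hypothesis W_le : forall t x, `|W t x| <= 1.
Hypothesis W_supp : forall t x, ~~ (0 <= t <= T) -> W t x = 0.
Hypothesis W_L2 : (\int[mu]_t \int[mu]_x (W t x ^+ 2)%:E < +oo)%E.
Hypothesis izeta : mu.-integrable [set: RR] (EFin \o zeta).
Hypothesis OmE : forall t x, Om t x = \int[mu]_y (W t y * zeta (x - y)).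
Hypothesis mOm : measurable_fun [set: RR * RR] (fun z => Om z.1 z.2).
Hypothesis Om_le : forall t x, `|Om t x| <= Z.
Hypothesis Om_supp : forall t x, ~~ (0 <= t <= T) -> Om t x = 0.
Hypothesis Om_L2 : (\int[mu]_t \int[mu]_x (Om t x ^+ 2)%:E < +oo)%E.
Hypothesis mk : measurable_fun [set: RR] k.
Hypothesis k_ge0 : forall h, 0 <= k h.
Hypothesis ip : mu.-integrable [set: RR] (EFin \o p).
Local Notation Theta := (second_difference k zeta).
Hypothesis Theta_le : forall u h, `|Theta u h| <= p h.
Hypothesis iTheta : (mu \x mu)%E.-integrable [set: RR * RR] (fun z => (Theta z.1 z.2)%:E).

Local Notation F := (primitive Om).
Let S (s x h : R) : R := convolution (fun u => Theta u h) (W s) x.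

Let mW1 s : measurable_fun [set: RR] (W s).
Proof. exact: (measurableT_comp mW (measurable_pair1 s)). Qed.

Let mTheta : measurable_fun [set: RR * RR] (fun z => Theta z.1 z.2).
Proof. by apply/measurable_EFinP; exact: (measurable_int _ iTheta). Qed.

Let iTheta_h u : mu.-integrable [set: RR] (EFin \o Theta u).
Proof.
apply: (integrable_dominated (X := RR) _ (Theta_le u) ip).
exact: (measurableT_comp mTheta (measurable_pair1 u)).
Qed.

Let iTheta_u h : mu.-integrable [set: RR] (EFin \o (Theta ^~ h)).
Proof.
have i1 := integrable_translation h izeta.
have i2 := integrable_translation (- h) izeta.
have := integrableB measurableT (integrableD measurableT i1 i2) (integrableZl measurableT 2 izeta).
by move/(integrableZl measurableT (k h)); apply: eq_integrable.
Qed.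

Let SE s x h : S s x h = k h * (Om s (x + h) + Om s (x - h) - 2 * Om s x).
Proof.
have i a := integrable_convolution_integrand izeta a (mW1 s) (W_le s).
rewrite !OmE /S /convolution.
have iD : mu.-integrable [set: RR]
    (EFin \o (fun y => W s y * zeta (x + h - y) + W s y * zeta (x - h - y))).
  by have := integrableD measurableT (i (x + h)) (i (x - h)); apply: eq_integrable.
have i2 : mu.-integrable [set: RR] (EFin \o (fun y => 2 * (W s y * zeta (x - y)))).
  by have := i x; move/(integrableZl measurableT 2); apply: eq_integrable.
have iB : mu.-integrable [set: RR]
    (EFin \o (fun y => W s y * zeta (x + h - y) + W s y * zeta (x - h - y) - 2 * (W s y * zeta (x - y)))).
  by have := integrableB measurableT iD i2; apply: eq_integrable.
rewrite -(RintegralD measurableT (i (x + h)) (i (x - h))).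
rewrite -(RintegralZl 2 measurableT (i x)).
rewrite -(RintegralB measurableT iD i2) -(RintegralZl (k h) measurableT iB).
apply: eq_Rintegral => y _; rewrite /second_difference.
rewrite (_ : x + h - y = x - y + h); last by ring.
rewrite (_ : x - h - y = x - y - h); last by ring.
by ring.
Qed.

Let mS x : measurable_fun [set: RR * RR] (fun z => S z.1 x z.2).
Proof.
rewrite (_ : (fun z => _) = (fun z : RR * RR => k z.2 *
   (Om z.1 (x + z.2) + Om z.1 (x - z.2) - 2 * Om z.1 x))); last first.
  by apply/funext => z; rewrite SE.
have mOm' (q : RR * RR -> RR) : measurable_fun [set: RR * RR] q ->
    measurable_fun [set: RR * RR] (fun z => Om z.1 (q z)).
  by move=> mq; apply: (measurable_fun_app2 (X := RR) (Y := RR) mOm) => //; exact: measurable_fst.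
apply: measurable_funM; first exact: (measurableT_comp mk measurable_snd).
apply: measurable_funB.
  apply: measurable_funD; apply: mOm'.
    by apply: measurable_funD => //; exact: measurable_snd.
  by apply: measurable_funB => //; exact: measurable_snd.
by apply: measurable_funM => //; apply: mOm'.
Qed.

Let B (h : R) : R := \int[mu]_u `|Theta u h|.

Let S_le s x h : `|S s x h| <= \1_`[0, T] s * B h.
Proof.
rewrite indicE mem_setE in_itv /=; have [sT|sT] := boolP (0 <= s <= T).
  by rewrite mul1r; exact: convolution_bounded.
by rewrite SE !Om_supp// addr0 mulr0 subr0 mulr0 normr0 mul0r.
Qed.

Let iB : mu.-integrable [set: RR] (EFin \o B).
Proof.
apply: (integrable_Rintegral (X := RR) (Y := RR) (f := fun h u => `|Theta u h|)).
apply: (integrable_swapped (X := RR) (Y := RR) (f := fun u h => `|Theta u h|)).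
exact: (integrable_norm iTheta).
Qed.

Let iThetaR x : (mu \x mu)%E.-integrable [set: RR * RR] (fun z => (Theta (x - z.1) z.2)%:E).
Proof.
apply: (integrable_prod (X := RR) (Y := RR) (f := fun y h => Theta (x - y) h)).
  apply: (measurable_fun_app2 (X := RR) (Y := RR) mTheta); last exact: measurable_snd.
  exact: (measurableT_comp (measurable_reflection x) measurable_fst).
have mnT : measurable_fun [set: RR * RR] (fun z => `|Theta z.1 z.2|%:E).
  by apply/measurable_EFinP; exact: measurableT_comp.
rewrite (integral_reflection x (f := fun u => \int[mu]_h `|Theta u h|%:E)%E); last first.
  exact: (@measurable_fun_fubini_tonelli_F _ _ RR RR _ mu (fun z => `|Theta z.1 z.2|%:E)).
by have /integrable12ltyP := iTheta; apply; exact/measurable_EFinP.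
Qed.

Let swap_S s x :
  \int[mu]_y (W s y * \int[mu]_h Theta (x - y) h) = \int[mu]_h S s x h.
Proof.
have mf : measurable_fun [set: RR * RR] (fun z => W s z.1 * Theta (x - z.1) z.2).
  apply: measurable_funM; first exact: (measurableT_comp (mW1 s) measurable_fst).
  by apply/measurable_EFinP; exact: (measurable_int _ (iThetaR x)).
have fi : (mu \x mu)%E.-integrable [set: RR * RR] (fun z => (W s z.1 * Theta (x - z.1) z.2)%:E).
  apply: (integrable_dominated (X := (RR * RR)%type)
    (g := fun z => `|Theta (x - z.1) z.2|) mf); last exact: (integrable_norm (iThetaR x)).
  by move=> z; rewrite normrM ler_piMl.
rewrite -(Rintegral_swap (X := RR) (Y := RR) (f := fun y h => W s y * Theta (x - y) h) fi).
apply: eq_Rintegral => y _; rewrite RintegralZl//.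
Qed.

Let iHS t x : (mu \x mu)%E.-integrable [set: RR * RR]
  (fun z => (heaviside (t - z.1) * S z.1 x z.2)%:E).
Proof.
apply: (integrable_dominated (X := (RR * RR)%type) (g := fun z => \1_`[0, T] z.1 * B z.2)).
- apply: measurable_funM; last exact: mS.
  exact: (measurableT_comp (measurable_heaviside_sub t) measurable_fst).
- move=> z; rewrite normrM; apply: le_trans (S_le z.1 x z.2).
  by rewrite ler_piMl// heaviside_norm.
- exact: (integrable_tensor (integrable_indic_itvR 0 T) iB).
Qed.

Let iOm : forall x, mu.-integrable [set: RR] (EFin \o (fun t => Om t x)).
Proof. exact: (integrable_in_time mOm Om_le Om_supp). Qed.

Let KQ t x h : R := k h * (F t (x + h) + F t (x - h) - 2 * F t x).

(** The convolution of W_s with the second difference of zeta is the second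
    difference of Om_s; integrating in time replaces Om by its primitive F. *)
Let KQE t x h : KQ t x h = \int[mu]_s (heaviside (t - s) * S s x h).
Proof.
have i a := integrable_heaviside t (iOm a).
have iD : mu.-integrable [set: RR] (EFin \o (fun s =>
    heaviside (t - s) * Om s (x + h) + heaviside (t - s) * Om s (x - h))).
  by have := integrableD measurableT (i (x + h)) (i (x - h)); apply: eq_integrable.
have i2 : mu.-integrable [set: RR] (EFin \o (fun s => 2 * (heaviside (t - s) * Om s x))).
  by have := i x; move/(integrableZl measurableT 2); apply: eq_integrable.
have iD2 : mu.-integrable [set: RR] (EFin \o (fun s =>
    heaviside (t - s) * Om s (x + h) + heaviside (t - s) * Om s (x - h) -
    2 * (heaviside (t - s) * Om s x))).
  by have := integrableB measurableT iD i2; apply: eq_integrable.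
rewrite /KQ /primitive -(RintegralD measurableT (i (x + h)) (i (x - h))).
rewrite -(RintegralZl 2 measurableT (i x)).
rewrite -(RintegralB measurableT iD i2) -(RintegralZl (k h) measurableT iD2).
apply: eq_Rintegral => s _; rewrite SE; ring.
Qed.

Let primitive_S t x : 0 <= t ->
  \int[mu]_(s in `[0, t]) \int[mu]_y (W s y * \int[mu]_h Theta (x - y) h) =
  \int[mu]_h KQ t x h.
Proof.
move=> t0; rewrite Rintegral_mkcond.
under [RHS]eq_Rintegral do rewrite KQE.
rewrite -(Rintegral_swap (X := RR) (Y := RR) (f := fun s h => heaviside (t - s) * S s x h) (iHS t x)).
apply: eq_Rintegral => s _.
have iS : mu.-integrable [set: RR] (EFin \o S s x).
  apply: (integrable_dominated (X := RR) (g := fun h => \1_`[0, T] s * B h)).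
  - exact: (measurableT_comp (mS x) (measurable_pair1 s)).
  - by move=> h; exact: S_le.
  - by have := iB; move/(integrableZl measurableT (\1_`[0, T] s)); apply: eq_integrable.
rewrite (RintegralZl (heaviside (t - s)) measurableT iS) -swap_S patchE mem_setE in_itv /=.
rewrite heavisideE subr_ge0; case: (leP 0 s) => s0 /=.
  by case: (s <= t); rewrite ?mul1r ?mul0r.
rewrite [X in _ * X](_ : _ = 0) ?mulr0//.
have W0 y : W s y = 0 by rewrite W_supp// negb_and -ltNge s0.
under eq_Rintegral do rewrite W0 mul0r.
by rewrite /Rintegral integral0.
Qed.
Let A (y : R) : R := \int[mu]_s `|W s y|.

Let mWt y : measurable_fun [set: RR] (fun s => W s y).
Proof. exact: (measurableT_comp mW (measurable_pair2 y)). Qed.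

Let iW y : mu.-integrable [set: RR] (EFin \o (fun s => W s y)).
Proof. by apply: (@integrable_supported R T _ 1) => // t; exact: W_supp. Qed.

Let mA : measurable_fun [set: RR] A.
Proof.
apply: (measurable_Rintegral (X := RR) (Y := RR) mu (f := fun y s => `|W s y|)).
apply: (measurable_swapped (X := RR) (Y := RR) (f := fun s y => `|W s y|)).
exact: measurableT_comp.
Qed.

Let A_le y : `|A y| <= \int[mu]_s \1_`[0, T] s.
Proof.
rewrite ger0_norm; last exact: Rintegral_ge0.
apply: le_Rintegral => //.
- exact: (integrable_norm (iW y)).
- exact: integrable_indic_itvR.
- move=> s _; rewrite -[leRHS]mul1r; apply: (@bounded_by_indic _ T (fun s => W s y)) => //.
  by move=> t; exact: W_supp.
Qed.

Let N (u : R) : R := \int[mu]_h `|Theta u h|.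

Let iN : mu.-integrable [set: RR] (EFin \o N).
Proof.
apply: (integrable_Rintegral (X := RR) (Y := RR) (f := fun u h => `|Theta u h|)).
exact: (integrable_norm iTheta).
Qed.

Let N_ge0 u : 0 <= N u. Proof. exact: Rintegral_ge0. Qed.

Let Yb (x : R) : R := convolution N A x.

Let iYb : mu.-integrable [set: RR] (EFin \o (fun x => Yb x ^+ 2)).
Proof.
have mY : measurable_fun [set: RR] Yb.
  apply: (@measurable_convolution R N iN _ RR (fun _ => A) id) => //.
  exact: (measurableT_comp mA measurable_snd).
apply/integrableP; split; first by apply/measurable_EFinP; exact: measurable_funX.
rewrite (_ : \int[mu]_x _ = \int[mu]_x (Yb x ^+ 2)%:E)%E; last first.
  by apply: eq_integral => x _ /=; rewrite ger0_norm// sqr_ge0.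
have iN_fin : (\int[mu]_x `|N x|%:E)%E \is a fin_num.
  exact: integrable_fin_num (integrable_norm iN).
have A2 : (\int[mu]_x (A x ^+ 2)%:E < +oo)%E.
  have /integrableP[_] := time_integral_L2 T_ge0 mW W_le W_supp W_L2.
  by under eq_integral do rewrite /= ger0_norm ?sqr_ge0//.
apply: (le_lt_trans (convolution_L2 iN mA)).
have q0 : (0 <= \int[mu]_x `|N x|%:E)%E by exact: integral_ge0.
by apply: lte_mul_pinfty => //; apply: lte_mul_pinfty.
Qed.

(** Integrating in h the convolution of W_s with the second difference gives at
    most the convolution of |W_s| with N(u) = int |Theta(u, h)| dh. *)
Let S_N s x : (\int[mu]_h `|S s x h|%:E <= \int[mu]_y (`|W s y| * N (x - y)%R)%:E)%E.
Proof.
have mf : measurable_fun [set: RR * RR] (fun z => `|W s z.1 * Theta (x - z.1) z.2|).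
  apply: measurableT_comp => //.
  apply: measurable_funM; first exact: (measurableT_comp (mW1 s) measurable_fst).
  by apply/measurable_EFinP; exact: (measurable_int _ (iThetaR x)).
have mEf : measurable_fun [set: RR * RR] (fun z => `|W s z.1 * Theta (x - z.1) z.2|%:E).
  exact/measurable_EFinP.
apply: (@le_trans _ _ (\int[mu]_h \int[mu]_y `|W s y * Theta (x - y)%R h|%:E)%E).
  apply: ge0_le_integral => //.
  - apply/measurable_EFinP; apply: measurableT_comp => //.
    exact: (measurableT_comp (mS x) (measurable_pair1 s)).
  - exact: (@measurable_fun_fubini_tonelli_G _ _ RR RR _ mu
      (fun z => `|W s z.1 * Theta (x - z.1) z.2|%:E)).
  - move=> h _; apply: abse_Rintegral_le.
    have ib := integrable_convolution_integrand (iTheta_u h) x (mW1 s) (W_le s).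
    by apply/measurable_EFinP; exact: (measurable_int _ ib).
rewrite -(@fubini_tonelli _ _ RR RR _ mu mu
  (fun z => `|W s z.1 * Theta (x - z.1) z.2|%:E))//.
rewrite le_eqVlt; apply/orP; left; apply/eqP; apply: eq_integral => y _ /=.
under eq_integral do rewrite normrM EFinM.
have inT := integrable_norm (iTheta_h (x - y)).
rewrite ge0_integralZl_EFin//; last exact: (measurable_int _ inT).
by rewrite -(EFin_Rintegral inT) -EFinM.
Qed.

Let KQ_bound t x : (\int[mu]_h `|KQ t x h|%:E <= (Yb x)%:E)%E.
Proof.
have mHS : measurable_fun [set: RR * RR] (fun z => heaviside (t - z.1) * S z.1 x z.2).
  by apply/measurable_EFinP; exact: (measurable_int _ (iHS t x)).
have mEnS : measurable_fun [set: RR * RR] (fun z => `|S z.1 x z.2|%:E).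
  by apply/measurable_EFinP; apply: measurableT_comp => //; exact: mS.
have mKQ : measurable_fun [set: RR] (KQ t x).
  rewrite (_ : KQ t x = fun h => \int[mu]_s (heaviside (t - s) * S s x h)); last first.
    by apply/funext => h; exact: KQE.
  apply: (measurable_Rintegral (X := RR) (Y := RR) mu (f := fun h s => heaviside (t - s) * S s x h)).
  exact: (measurable_swapped (X := RR) (Y := RR) (f := fun s h => heaviside (t - s) * S s x h)).
apply: (@le_trans _ _ (\int[mu]_h \int[mu]_s `|S s x h|%:E)%E).
  apply: ge0_le_integral => //.
  - by apply/measurable_EFinP; exact: measurableT_comp.
  - exact: (@measurable_fun_fubini_tonelli_G _ _ RR RR _ mu (fun z => `|S z.1 x z.2|%:E)).
  move=> h _; rewrite KQE.
  have mHSh : measurable_fun [set: RR] (fun s => heaviside (t - s) * S s x h).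
    exact: (measurableT_comp mHS (measurable_pair2 h)).
  apply: le_trans (abse_Rintegral_le _ mHSh) _.
  apply: ge0_le_integral => //.
  - by apply/measurable_EFinP; exact: measurableT_comp.
  - exact: (measurableT_comp mEnS (measurable_pair2 h)).
  - by move=> s _; rewrite lee_fin normrM ler_piMl// heaviside_norm.
rewrite -(@fubini_tonelli _ _ RR RR _ mu mu (fun z => `|S z.1 x z.2|%:E))//.
have mWN : measurable_fun [set: RR * RR] (fun z => (`|W z.1 z.2| * N (x - z.2))%:E).
  apply/measurable_EFinP; apply: measurable_funM; first exact: measurableT_comp.
  have /measurable_EFinP mN := measurable_int _ (integrable_reflection x iN).
  exact: (measurableT_comp mN measurable_snd).
have WN0 z : (0 <= (`|W z.1 z.2| * N (x - z.2))%:E)%E by rewrite lee_fin mulr_ge0.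
apply: (@le_trans _ _ (\int[mu]_s \int[mu]_y (`|W s y| * N (x - y)%R)%:E)%E).
  apply: ge0_le_integral => //.
  - by move=> s _; exact: integral_ge0.
  - exact: (@measurable_fun_fubini_tonelli_F _ _ RR RR _ mu (fun z => `|S z.1 x z.2|%:E)).
  - exact: (@measurable_fun_fubini_tonelli_F _ _ RR RR _ mu
      (fun z => (`|W z.1 z.2| * N (x - z.2))%:E)).
  - by move=> s _; exact: S_N.
have -> : (\int[mu]_s \int[mu]_y (`|W s y| * N (x - y)%R)%:E =
    \int[mu]_y \int[mu]_s (`|W s y| * N (x - y)%R)%:E)%E.
  exact: (@fubini_tonelli _ _ RR RR _ mu mu (fun z => (`|W z.1 z.2| * N (x - z.2))%:E)).
rewrite EFin_Rintegral; last exact: (integrable_convolution_integrand iN x mA A_le).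
rewrite le_eqVlt; apply/orP; left; apply/eqP; apply: eq_integral => y _ /=.
under eq_integral do rewrite EFinM.
rewrite ge0_integralZr//; last 2 first.
- exact: (measurable_int _ (integrable_norm (iW y))).
- by rewrite lee_fin.
by rewrite -(EFin_Rintegral (integrable_norm (iW y))) -EFinM.
Qed.
Let iKQ t x : mu.-integrable [set: RR] (EFin \o KQ t x).
Proof.
have mHS : measurable_fun [set: RR * RR] (fun z => heaviside (t - z.1) * S z.1 x z.2).
  by apply/measurable_EFinP; exact: (measurable_int _ (iHS t x)).
apply/integrableP; split.
  apply/measurable_EFinP.
  rewrite (_ : KQ t x = fun h => \int[mu]_s (heaviside (t - s) * S s x h)); last first.
    by apply/funext => h; exact: KQE.
  apply: (measurable_Rintegral (X := RR) (Y := RR) mu (f := fun h s => heaviside (t - s) * S s x h)).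
  exact: (measurable_swapped (X := RR) (Y := RR) (f := fun s h => heaviside (t - s) * S s x h)).
by apply: (le_lt_trans (KQ_bound t x)); rewrite ltry.
Qed.

Let mK : measurable_fun [set: (RR * RR) * RR] (fun z => KQ z.1.1 z.1.2 z.2 * Om z.1.1 z.1.2).
Proof.
have m11 : measurable_fun [set: (RR * RR) * RR] (fun z => z.1.1 : RR).
  exact: (measurableT_comp measurable_fst measurable_fst).
have m12 : measurable_fun [set: (RR * RR) * RR] (fun z => z.1.2 : RR).
  exact: (measurableT_comp measurable_snd measurable_fst).
have m2 : measurable_fun [set: (RR * RR) * RR] (fun z => z.2 : RR).
  exact: measurable_snd.
have mF := measurable_primitive mOm.
have mF' (q : (RR * RR) * RR -> RR) : measurable_fun [set: (RR * RR) * RR] q ->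
    measurable_fun [set: (RR * RR) * RR] (fun z => F z.1.1 (q z)).
  by move=> mq; exact: (measurable_fun_app2 (X := RR) (Y := RR) mF m11 mq).
apply: measurable_funM; last exact: (measurable_fun_app2 (X := RR) (Y := RR) mOm m11 m12).
apply: measurable_funM; first exact: (measurableT_comp mk m2).
apply: measurable_funB.
  by apply: measurable_funD; apply: mF'; [exact: measurable_funD|exact: measurable_funB].
by apply: measurable_funM => //; exact: mF'.
Qed.

Let iK : (plane_measure \x mu)%E.-integrable [set: (RR * RR) * RR]
  (fun z => (KQ z.1.1 z.1.2 z.2 * Om z.1.1 z.1.2)%:E).
Proof.
apply: (integrable_prod (X := (RR * RR)%type) (Y := RR) (m1 := plane_measure)
  (f := fun z h => KQ z.1 z.2 h * Om z.1 z.2)); first exact: mK.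
pose G (z : RR * RR) := \1_`[0, T] z.1 * Yb z.2 ^+ 2 + Om z.1 z.2 ^+ 2.
have iG : (mu \x mu)%E.-integrable [set: RR * RR] (EFin \o G).
  have := integrableD measurableT (integrable_tensor (integrable_indic_itvR 0 T) iYb)
    (integrable_sqr_time_space mOm Om_L2).
  exact: eq_integrable.
apply: (@le_lt_trans _ _ (\int[(mu \x mu)%E]_z (G z)%:E)%E); last first.
  exact: (integrable_lty measurableT iG).
apply: ge0_le_integral => //.
- by move=> z _; exact: integral_ge0.
- apply: (@measurable_fun_fubini_tonelli_F _ _ (RR * RR)%type RR _ mu
    (fun z => `|KQ z.1.1 z.1.2 z.2 * Om z.1.1 z.1.2|%:E)) => //.
  by apply/measurable_EFinP; apply: measurableT_comp => //; exact: mK.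
- exact: (measurable_int _ iG).
move=> z _; under eq_integral do rewrite normrM EFinM.
rewrite ge0_integralZr//; last exact: (measurable_int _ (integrable_norm (iKQ z.1 z.2))).
apply: (@le_trans _ _ ((Yb z.2)%:E * `|Om z.1 z.2|%:E)%E).
  by apply: lee_wpmul2r => //; exact: KQ_bound.
rewrite -EFinM lee_fin /G indicE mem_setE in_itv /=.
have [tT|tT] := boolP (0 <= z.1 <= T); last first.
  by rewrite Om_supp// normr0 mulr0 mul0r expr0n addr0.
rewrite mul1r -[Om _ _ ^+ 2]real_normK ?num_real//.
have := sqr_ge0 (Yb z.2 - `|Om z.1 z.2|); have := sqr_ge0 (Yb z.2 + `|Om z.1 z.2|).
nra.
Qed.

(** The energy inequality: if om_t is C times the time integral over [0, t] of
    the convolution of W_s with int Theta(., h) dh, then the integral of om Om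
    over time and space is at most 0. *)
Lemma energy_le0 (C : R) (om : R -> R -> R) : 0 <= C ->
  (forall t x, 0 <= t <= T -> om t x =
     C * \int[mu]_(s in `[0, t]) \int[mu]_y (W s y * \int[mu]_h Theta (x - y) h)) ->
  \int[(mu \x mu)%E]_z (om z.1 z.2 * Om z.1 z.2) <= 0.
Proof.
move=> C0 omE.
have -> : \int[(mu \x mu)%E]_z (om z.1 z.2 * Om z.1 z.2) =
    \int[(mu \x mu)%E]_z (C * \int[mu]_h (KQ z.1 z.2 h * Om z.1 z.2)).
  apply: eq_Rintegral => z _; rewrite (RintegralZr _ measurableT (iKQ z.1 z.2)).
  have [tT|tT] := boolP (0 <= z.1 <= T); last by rewrite Om_supp// !mulr0.
  by rewrite omE// primitive_S ?mulrA//; case/andP: tT.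
rewrite (RintegralZl C measurableT (integrable_Rintegral (X := (RR * RR)%type) (Y := RR)
  (f := fun z h => KQ z.1 z.2 h * Om z.1 z.2) iK)).
rewrite mulr_ge0_le0//.
rewrite (Rintegral_swap (X := (RR * RR)%type) (Y := RR)
  (f := fun z h => KQ z.1 z.2 h * Om z.1 z.2) iK).
rewrite -oppr_ge0 -mulN1r -RintegralZl//; last first.
  apply: (integrable_Rintegral (X := RR) (Y := (RR * RR)%type)
    (f := fun h z => KQ z.1 z.2 h * Om z.1 z.2)).
  exact: (integrable_swapped (X := (RR * RR)%type) (Y := RR)
    (f := fun z h => KQ z.1 z.2 h * Om z.1 z.2) iK).
apply: Rintegral_ge0 => h _; rewrite mulN1r oppr_ge0.
have iE a := integrable_primitive_mul T_ge0 mOm Om_le Om_supp Om_L2 a.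
rewrite [leLHS](_ : _ = k h * (correlation Om h + correlation Om (- h) - 2 * correlation Om 0)); last first.
  have iD : (mu \x mu)%E.-integrable [set: RR * RR] (EFin \o (fun z =>
      F z.1 (z.2 + h) * Om z.1 z.2 + F z.1 (z.2 + - h) * Om z.1 z.2)).
    by have := integrableD measurableT (iE h) (iE (- h)); apply: eq_integrable.
  have i2 : (mu \x mu)%E.-integrable [set: RR * RR]
      (EFin \o (fun z => 2 * (F z.1 (z.2 + 0) * Om z.1 z.2))).
    by have := iE 0; move/(integrableZl measurableT 2); apply: eq_integrable.
  have iD2 : (mu \x mu)%E.-integrable [set: RR * RR] (EFin \o (fun z =>
      F z.1 (z.2 + h) * Om z.1 z.2 + F z.1 (z.2 + - h) * Om z.1 z.2 -
      2 * (F z.1 (z.2 + 0) * Om z.1 z.2))).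
    by have := integrableB measurableT iD i2; apply: eq_integrable.
  rewrite /correlation -(RintegralD measurableT (iE h) (iE (- h))).
  rewrite -(RintegralZl 2 measurableT (iE 0)) -(RintegralB measurableT iD i2).
  rewrite -(RintegralZl (k h) measurableT iD2).
  by apply: eq_Rintegral => z _; rewrite /KQ addr0; ring.
by rewrite mulr_ge0_le0//; exact: (correlation_le0 T_ge0 mOm Om_le Om_supp Om_L2).
Qed.

End energy.

(** * Smooth functions flat at the origin *)

Section flat_functions.
Context {R : realType}.
Implicit Types (P : {poly R}) (x y h : R).

(** The function equal to P(1/x) exp(-1/x) for x > 0 and to 0 for x <= 0.  These
    functions, with P ranging over the polynomials, are stable under
    differentiation. *)
Definition flat P x : R := if 0 < x then P.[x^-1] * expR (- x^-1) else 0.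

(** The polynomial of the derivative of [flat P]. *)
Definition flat_deriv P : {poly R} := 'X^2 * (P - P^`()).

Lemma flat0 P x : x <= 0 -> flat P x = 0.
Proof. by rewrite /flat ltNge => ->. Qed.

Lemma poly_growth P : exists K : R, 0 <= K /\
  forall y, 1 <= y -> `|P.[y]| <= K * y ^+ size P.
Proof.
exists (\sum_(i < size P) `|P`_i|); split; first exact: sumr_ge0.
move=> y y1; rewrite horner_coef mulr_suml.
apply: le_trans (ler_norm_sum _ _ _) _; apply: ler_sum => i _.
have y0 : 0 <= y by exact: le_trans y1.
rewrite normrM ler_wpM2l// ger0_norm ?exprn_ge0//.
by rewrite ler_weXn2l// ltnW.
Qed.

(** A flat function is O(h^2) at 0, hence differentiable there with derivative
    0. *)
Lemma flat_bound P : exists K : R, 0 <= K /\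
  forall h, h <= 1 -> `|flat P h| <= K * h ^+ 2.
Proof.
have [K [K0 PK]] := poly_growth P.
pose n := (size P).+1.
exists (K * (n.+1)`!%:R); split; first by rewrite mulr_ge0// ler0n.
move=> h h1; have [h0|h0] := ltP 0 h; last first.
  by rewrite flat0// normr0; apply: mulr_ge0; [apply: mulr_ge0; rewrite ?ler0n|exact: sqr_ge0].
rewrite /flat h0; set y := h^-1.
have y0 : 0 < y by rewrite invr_gt0.
have y1 : 1 <= y by rewrite invf_ge1.
rewrite normrM (ger0_norm (expR_ge0 _)) expRN.
have fn0 : 0 < (n.+1)`!%:R :> R by rewrite ltr0n fact_gt0.
have ey : y ^+ n.+1 / (n.+1)`!%:R <= expR y.
  by apply: le_trans (expR_ge1Dxn n (ltW y0)); rewrite lerDr.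
have yn0 : 0 < y ^+ n.+1 by rewrite exprn_gt0.
have ey' : (expR y)^-1 <= (n.+1)`!%:R / y ^+ n.+1.
  by rewrite -[leRHS]invrK lef_pV2 ?posrE ?expR_gt0 ?invr_gt0 ?divr_gt0// invf_div.
apply: (@le_trans _ _ (K * y ^+ size P * ((n.+1)`!%:R / y ^+ n.+1))).
  apply: ler_pM => //; last exact: PK.
have -> : h = y^-1 by rewrite invrK.
rewrite /n [y ^+ (size P).+2](_ : _ = y ^+ 2 * y ^+ size P); last by rewrite -exprD.
have ys : y ^+ size P != 0 by rewrite expf_neq0// gt_eqF.
have y2 : y != 0 by rewrite gt_eqF.
rewrite le_eqVlt; apply/orP; left; apply/eqP; field.
by rewrite ys y2.
Qed.

Lemma is_derive_flat P x : is_derive x 1 (flat P) (flat (flat_deriv P) x).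
Proof.
have [x0|x0|->] := ltgtP x 0.
- rewrite [flat (flat_deriv P) x]flat0 ?ltW//.
  apply: (@near_eq_is_derive _ _ _ (fun=> 0)).
  by near=> y; rewrite flat0// ltW//; near: y; exact: lt_nbhsl.
- apply: (@near_eq_is_derive _ _ _ (fun y => P.[y^-1] * expR (- y^-1))).
    near=> y; rewrite /flat ifT//; near: y; exact: lt_nbhsr.
  have dV : is_derive x 1 (fun y => y^-1 : R) (- x ^- 2).
    apply: is_derive_eq; first by apply: is_deriveV; rewrite gt_eqF.
    by rewrite scaler1.
  have dP : is_derive x 1 (horner P \o (fun y => y^-1)) (P^`().[x^-1] * (- x ^- 2)).
    by apply: is_derive1_comp; exact: is_derive_poly.
  have dE : is_derive x 1 (expR \o (fun y => - y^-1)) (expR (- x^-1) * (x ^- 2)).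
    apply: is_derive1_comp.
    by apply: is_derive_eq; rewrite opprK.
  apply: (@is_derive_eq _ _ _ _ _ _ _ _ (is_deriveM dP dE)).
  rewrite /= /flat x0 /flat_deriv !hornerE /= /GRing.scale /=.
  by rewrite exprVn; ring.
- rewrite [flat (flat_deriv P) 0]flat0//.
  have [K [K0 PK]] := flat_bound P.
  have H : (h^-1 *: ((flat P \o shift 0) (h *: (1 : R)) - flat P 0)) @[h --> 0^'] --> (0 : R).
    apply: (@cvg_to_0_linear _ _ K 1) => // h /andP[h0 h1].
    rewrite [flat P 0]flat0// subr0 /= addr0 /GRing.scale /= mulr1.
    rewrite normrM normfV mulrC ler_pdivrMr// -mulrA -expr2 real_normK ?num_real//.
    by apply: PK; rewrite (le_trans (ler_norm h))// ltW.
  by apply: DeriveDef; [apply/cvg_ex; exists 0|exact: cvg_lim].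
Unshelve. all: by end_near. Qed.

(** The functions obtained from flat functions of an affine argument by sums and
    products.  This class is stable under differentiation, so all of its
    members are smooth. *)
Inductive flat_algebra : (R -> R) -> Prop :=
| flat_algebra_base P (a b : R) : flat_algebra (fun x => flat P (a * x + b))
| flat_algebra_add f g : flat_algebra f -> flat_algebra g ->
    flat_algebra (fun x => f x + g x)
| flat_algebra_mul f g : flat_algebra f -> flat_algebra g ->
    flat_algebra (fun x => f x * g x).

Lemma flat_algebra_derive f : flat_algebra f ->
  exists2 df, flat_algebra df & forall x, is_derive x 1 f (df x).
Proof.
elim=> [P a b|{}f g _ [df adf fdf] _ [dg adg gdg]|{}f g af [df adf fdf] ag [dg adg gdg]].
- exists (fun x => flat (a%:P * flat_deriv P) (a * x + b)).
    exact: flat_algebra_base.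
  move=> x; have da : is_derive x 1 (fun x : R => a * x + b) a.
    by apply: is_derive_eq; rewrite /GRing.scale /= mulr1 addr0.
  have := @is_derive1_comp _ (flat P) (fun x => a * x + b) x _ _ (is_derive_flat P _) da.
  move=> H; apply: (is_derive_eq H); rewrite /flat; case: ifP => _; last by rewrite mul0r.
  by rewrite (hornerM a%:P) hornerC; ring.
- exists (fun x => df x + dg x); first exact: flat_algebra_add.
  by move=> x; apply: (is_derive_eq (is_deriveD (fdf x) (gdg x))).
- exists (fun x => f x * dg x + g x * df x).
    by apply: flat_algebra_add; apply: flat_algebra_mul.
  by move=> x; apply: (is_derive_eq (is_deriveM (fdf x) (gdg x))).
Qed.

Lemma flat_algebra_smooth f : flat_algebra f -> smooth f.
Proof.
move=> af n x.
suff /flat_algebra_derive[df _ /(_ x) H] : flat_algebra (derive1n n f) by exact: ex_derive.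
elim: n {x} => [//|n IH]; rewrite derive1nS.
have [df adf ndf] := flat_algebra_derive IH.
rewrite (_ : derive1 _ = df)//; apply/funext => x.
by rewrite derive1E; have := ndf x => ?; exact: derive_val.
Qed.

Lemma flat_algebra_continuous f : flat_algebra f -> continuous f.
Proof.
move=> /flat_algebra_derive[df _ fdf] x; apply: differentiable_continuous.
by apply/derivable1_diffP; have := fdf x => ?; exact: ex_derive.
Qed.

(** For small steps the bound comes from the mean value theorem used twice and
    a bound of the second derivative on a compact interval; for steps larger
    than 1 it comes from the bound M of f itself. *)
Lemma flat_algebra_second_difference f (M r : R) : flat_algebra f ->
  (forall x, `|f x| <= M) -> (forall x, r < `|x| -> f x = 0) ->
  exists2 C : R, 0 <= C & forall u h, `|f (u + h) + f (u - h) - 2 * f u| <= C * h ^+ 2.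
Proof.
move=> af fM f0; have [df adf fdf] := flat_algebra_derive af.
have [ddf addf dfddf] := flat_algebra_derive adf.
have cont g (a b : R) : flat_algebra g -> {within `[a, b], continuous g}.
  by move=> ag; apply: continuous_subspaceT; exact: flat_algebra_continuous.
have M0 : 0 <= M by exact: le_trans (normr_ge0 _) (fM 0).
have [K K0 HK] : exists2 K : R, 0 <= K &
    forall x, x \in `[- (`|r| + 2), `|r| + 2] -> `|ddf x| <= K.
  have le2 : - (`|r| + 2) <= `|r| + 2 by have := normr_ge0 r; lra.
  have cn : {within `[- (`|r| + 2), `|r| + 2], continuous (fun x => `|ddf x|)}.
    apply: continuous_subspaceT => x.
    apply: (@continuous_comp _ _ _ ddf Num.norm); first exact: flat_algebra_continuous.
    exact: norm_continuous.
  have [c _ Hc] := EVT_max le2 cn.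
  by exists `|ddf c|.
(* 2 K comes from steps at most 1, and 4 M from larger steps *)
exists (2 * K + 4 * M); first by lra.
have pos u h : 0 < h -> `|f (u + h) + f (u - h) - 2 * f u| <= (2 * K + 4 * M) * h ^+ 2.
  move=> h0; have h20 : 0 <= h ^+ 2 by exact: sqr_ge0.
  have [h1|h1] := leP h 1; last first.
    have h21 : 1 <= h ^+ 2 by rewrite expr_ge1// ltW.
    have B : `|f (u + h) + f (u - h) - 2 * f u| <= 4 * M.
      have := fM (u + h); have := fM (u - h); have := fM u.
      by rewrite !ler_norml => /andP[? ?] /andP[? ?] /andP[? ?]; apply/andP; split; lra.
    apply: (le_trans B).
    by nra.
  have [ur|ur] := leP `|u| (r + 1); last first.
    have Z x : `|x - u| <= 1 -> f x = 0.
      move=> xu; apply: f0; have := ler_normB x u => _.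
      have : `|u| <= `|x| + `|x - u|.
        rewrite -{1}(subrK x u) addrC -(opprB x u).
        by apply: le_trans (ler_normB _ _) _.
      by lra.
    rewrite !Z ?mulr0 ?subr0 ?addr0 ?normr0.
    - by apply: mulr_ge0 => //; lra.
    - by rewrite subrr normr0.
    - by rewrite addrAC subrr add0r normrN gtr0_norm.
    - by rewrite addrAC subrr add0r gtr0_norm.
  have [c1 c1i E1] : exists2 c, c \in `]u, u + h[ & f (u + h) - f u = df c * (u + h - u).
    by apply: MVT => //; [lra|exact: cont].
  have [c2 c2i E2] : exists2 c, c \in `]u - h, u[ & f u - f (u - h) = df c * (u - (u - h)).
    by apply: MVT => //; [lra|exact: cont].
  move: c1i c2i; rewrite !in_itv /= => /andP[c1l c1r] /andP[c2l c2r].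
  have [c3 c3i E3] : exists2 c, c \in `]c2, c1[ & df c1 - df c2 = ddf c * (c1 - c2).
    by apply: MVT => //; [lra|exact: cont].
  move: c3i; rewrite in_itv /= => /andP[c3l c3r].
  have -> : f (u + h) + f (u - h) - 2 * f u = ddf c3 * ((c1 - c2) * h).
    by rewrite mulrA -E3; lra.
  have c12 : 0 <= (c1 - c2) * h by apply: mulr_ge0; lra.
  rewrite normrM (ger0_norm c12).
  have dK : `|ddf c3| <= K.
    apply: HK; rewrite in_itv /=; move: ur; rewrite ler_norml => /andP[u1 u2].
    by have := ler_norm r; move=> ?; apply/andP; split; lra.
  apply: (@le_trans _ _ (K * (2 * h ^+ 2))).
    apply: ler_pM => //; rewrite expr2 mulrA ler_wpM2r//; lra.
  by nra.
move=> u h; have [h0|h0|->] := ltgtP h 0.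
- have := pos u (- h); rewrite oppr_gt0 sqrrN opprK => /(_ h0).
  by rewrite [f (u - h) + _]addrC.
- exact: pos.
- rewrite subr0 addr0 (_ : f u + f u - 2 * f u = 0); last by ring.
  by rewrite normr0 expr0n mulr0.
Qed.

End flat_functions.

(** * Mollifiers *)

Section mollifier.
Context {R : realType}.
Local Notation mu := (@lebesgue_measure R).
Local Notation RR := (measurableTypeR R).

Lemma flat_const (c x : R) : flat c%:P x = c * flat 1 x.
Proof.
rewrite /flat; case: ifP => _; last by rewrite mulr0.
by rewrite -polyC1 !hornerC mul1r.
Qed.

Lemma flat1_ge0 (x : R) : 0 <= flat 1 x.
Proof. by rewrite /flat; case: ifP => // _; rewrite !hornerE expR_ge0. Qed.

Lemma flat1_le1 (x : R) : flat 1 x <= 1.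
Proof.
rewrite /flat; case: ifP => // x0; rewrite !hornerE -expR0 ler_expR.
by rewrite oppr_le0 invr_ge0 ltW.
Qed.

Lemma flat1_ge (x : R) : 2^-1 <= x -> expR (- 2) <= flat 1 x.
Proof.
move=> x2; have x0 : 0 < x by apply: lt_le_trans x2; rewrite invr_gt0.
rewrite /flat x0 !hornerE ler_expR lerN2 -[leRHS]invrK lef_pV2// ?posrE//.
Qed.

(** A bump function supported in [-r, r], not normalized. *)
Definition bump (r x : R) : R := flat 1 (r^-1 * x + 1) * flat 1 (- r^-1 * x + 1).

(** The bump function divided by its integral.  The constant is put into the
    polynomial of the first factor, so that the quotient visibly belongs to
    [flat_algebra]. *)
Definition mollifier (r x : R) : R :=
  flat (\int[mu]_y bump r y)^-1%:P (r^-1 * x + 1) * flat 1 (- r^-1 * x + 1).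

Lemma mollifierE r x : mollifier r x = (\int[mu]_y bump r y)^-1 * bump r x.
Proof. by rewrite /mollifier flat_const mulrA. Qed.

Lemma mollifier_flat_algebra r : flat_algebra (mollifier r).
Proof. by apply: flat_algebra_mul; exact: flat_algebra_base. Qed.

Lemma mollifier_flat_algebra_reflection r x :
  flat_algebra (fun u => mollifier r (x - u)).
Proof.
have aff (P : {poly R}) (a : R) : flat_algebra (fun u => flat P (a * (x - u) + 1)).
  rewrite (_ : (fun _ => _) = fun u => flat P (- a * u + (a * x + 1))).
    exact: flat_algebra_base.
  by apply/funext => u; congr flat; ring.
by apply: flat_algebra_mul; exact: aff.
Qed.

Variable r : R.
Hypothesis r_gt0 : 0 < r.

Lemma bump_ge0 x : 0 <= bump r x.
Proof. by rewrite mulr_ge0// flat1_ge0. Qed.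

Lemma bump_le1 x : bump r x <= 1.
Proof. by rewrite mulr_ile1// ?flat1_ge0 ?flat1_le1. Qed.

Lemma bump_supp x : r <= `|x| -> bump r x = 0.
Proof.
have [x0|x0] := leP 0 x => rx; rewrite /bump.
  rewrite [X in _ * X]flat0 ?mulr0// mulNr addrC subr_le0 mulrC ler_pdivlMr// mul1r.
  by rewrite -(ger0_norm x0).
rewrite [X in X * _]flat0 ?mul0r//.
rewrite -[X in X + _]opprK addrC subr_le0 -mulrN mulrC ler_pdivlMr// mul1r.
by rewrite -(ltr0_norm x0).
Qed.

Lemma bump_ge x : `|x| <= r / 2 -> expR (- 4) <= bump r x.
Proof.
move=> xr; have -> : - 4 = - 2 + - 2 :> R by lra.
have {}xr : `|r^-1 * x| <= 2^-1.
  by rewrite normrM normfV (gtr0_norm r_gt0) mulrC ler_pdivrMr// mulrC.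
have /andP[l u] : - 2^-1 <= r^-1 * x <= 2^-1 by rewrite -ler_norml.
rewrite expRD; apply: ler_pM; rewrite ?expR_ge0//; apply: flat1_ge.
  by lra.
by rewrite mulNr; lra.
Qed.

Lemma measurable_flat_algebra (f : R -> R) : flat_algebra f ->
  measurable_fun [set: RR] f.
Proof.
by move=> /flat_algebra_continuous; exact: continuous_measurable_fun.
Qed.

Lemma integrable_bump : mu.-integrable [set: RR] (EFin \o bump r).
Proof.
apply: (integrable_dominated (X := RR) _ _ (integrable_indic_itvR (- r) r)).
  by apply: measurable_flat_algebra; apply: flat_algebra_mul; exact: flat_algebra_base.
move=> x; rewrite ger0_norm ?bump_ge0// indicE mem_setE in_itv /= -ler_norml.
have [xr|xr] := leP `|x| r; first exact: bump_le1.
by rewrite bump_supp// ltW.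
Qed.

Lemma bump_mass : expR (- 4) * r <= \int[mu]_x bump r x.
Proof.
have -> : expR (- 4) * r = \int[mu]_x (expR (- 4) * \1_`[- (r / 2), r / 2] x).
  rewrite RintegralZl//; last exact: integrable_indic_itvR.
  congr (_ * _); rewrite /Rintegral.
  have -> : (\int[mu]_x (\1_`[(- (r / 2))%R, (r / 2)%R] x)%:E = mu `[(- (r / 2))%R, (r / 2)%R])%E.
    by rewrite integral_indic// setIT.
  rewrite lebesgue_measure_itv/= lte_fin.
  have -> : - (r / 2) < r / 2 by have := r_gt0; lra.
  by rewrite -EFinB /=; lra.
apply: le_Rintegral => //.
- have := integrable_indic_itvR (- (r / 2)) (r / 2).
  by move/(integrableZl measurableT (expR (- 4))); apply: eq_integrable.
- exact: integrable_bump.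
move=> x _; rewrite indicE mem_setE in_itv /= -ler_norml.
have [xr|xr] := leP `|x| (r / 2); first by rewrite mulr1 bump_ge.
by rewrite mulr0 bump_ge0.
Qed.

Let mass_gt0 : 0 < \int[mu]_x bump r x.
Proof. by apply: lt_le_trans bump_mass; rewrite mulr_gt0// expR_gt0. Qed.

Lemma mollifier_ge0 x : 0 <= mollifier r x.
Proof. by rewrite mollifierE mulr_ge0 ?bump_ge0// invr_ge0 ltW. Qed.

Lemma mollifier_le x : mollifier r x <= expR 4 / r.
Proof.
rewrite mollifierE; apply: (@le_trans _ _ ((\int[mu]_y bump r y)^-1 * 1)).
  by rewrite ler_wpM2l ?bump_le1// invr_ge0 ltW.
rewrite mulr1 -[expR 4]invrK -expRN -invfM lef_pV2 ?posrE//; last first.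
  by rewrite mulr_gt0// expR_gt0.
exact: bump_mass.
Qed.

Lemma mollifier_supp x : r <= `|x| -> mollifier r x = 0.
Proof. by move=> rx; rewrite mollifierE bump_supp// mulr0. Qed.

Lemma integrable_mollifier : mu.-integrable [set: RR] (EFin \o mollifier r).
Proof.
have := integrable_bump.
move/(integrableZl measurableT (\int[mu]_y bump r y)^-1); apply: eq_integrable => //.
by move=> x _; rewrite /= mollifierE.
Qed.

Lemma mollifier_mass : \int[mu]_x mollifier r x = 1.
Proof.
under eq_Rintegral do rewrite mollifierE.
by rewrite RintegralZl ?mulVf ?gt_eqF//; exact: integrable_bump.
Qed.

Lemma flat_algebra_Ccinfty (f : R -> R) (a b : R) : flat_algebra f ->
  (forall x, ~~ (a <= x <= b) -> f x = 0) -> Ccinfty f.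
Proof.
move=> af f0; split; first exact: flat_algebra_smooth.
apply: (subclosed_compact _ (@segment_compact R a b)); first exact: closed_closure.
have /closure_id -> : closed `[a, b]%classic by exact: itv_closed.
apply: closure_subset => x /= fx; rewrite in_itv /=.
by apply/negPn/negP => /f0 /eqP; exact/negP.
Qed.

End mollifier.

(** * The jump kernel *)

Section kernel.
Context {R : realType}.
Local Notation mu := (@lebesgue_measure R).
Local Notation RR := (measurableTypeR R).

Lemma powR_continuous_at (a x : R) : 0 < x -> {for x, continuous (fun y : R => y `^ a)}.
Proof.
move=> x0; apply: differentiable_continuous; apply/derivable1_diffP.
by have := is_derive1_powR a x0 => ?; exact: ex_derive.
Qed.

Lemma integral_powR (a x y : R) : a != 0 -> 0 < x -> x < y ->
  (\int[mu]_(h in `[x, y]) (h `^ (a - 1))%:E = ((y `^ a - x `^ a) / a)%:E)%E.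
Proof.
move=> a0 x0 xy; have y0 : 0 < y by exact: lt_trans xy.
have dF (h : R) : 0 < h -> is_derive h 1 (fun t : R => a^-1 * t `^ a) (h `^ (a - 1)).
  move=> h0; have H := is_derive1_powR a h0.
  apply: (is_derive_eq (is_deriveZ a^-1 H)).
  by rewrite /GRing.scale /= mulrA mulVf// mul1r.
have cF (h : R) : 0 < h -> {for h, continuous (fun t : R => a^-1 * t `^ a)}.
  move=> h0; apply: differentiable_continuous; apply/derivable1_diffP.
  by have := dF h h0 => ?; exact: ex_derive.
rewrite (@continuous_FTC2 _ _ (fun t : R => a^-1 * t `^ a))//.
- by rewrite -EFinB; congr EFin; rewrite -mulrBr mulrC.
- apply: continuous_in_subspaceT => h; rewrite inE /= in_itv /= => /andP[xh _].
  by apply: powR_continuous_at; exact: lt_le_trans xh.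
- split.
  + move=> h; rewrite in_itv /= => /andP[xh _].
    by have := dF h (lt_trans x0 xh) => ?; exact: ex_derive.
  + by apply: cvg_at_right_filter; exact: cF.
  + by apply: cvg_at_left_filter; exact: cF.
- move=> h; rewrite in_itv /= => /andP[xh _].
  by rewrite derive1E; have := dF h (lt_trans x0 xh) => ?; exact: derive_val.
Qed.

Variable gamma : R.
Hypothesis gamma_in : 0 < gamma < 2.

(** The kernel |h|^(-1-gamma); its value at 0 is the inverse of 0, that is 0. *)
Definition jump_kernel (h : R) : R := (`|h| `^ (1 + gamma))^-1.
Local Notation k := jump_kernel.

(** The integrable function min(h^2, 1) |h|^(-1-gamma), which dominates
    second differences weighted by the jump kernel. *)
Definition levy_weight (h : R) : R := Num.min (h ^+ 2) 1 * k h.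
Local Notation p := levy_weight.

Lemma jump_kernel_ge0 h : 0 <= k h.
Proof. by rewrite invr_ge0 powR_ge0. Qed.

Lemma jump_kernelN h : k (- h) = k h.
Proof. by rewrite /jump_kernel normrN. Qed.

Lemma measurable_jump_kernel : measurable_fun [set: RR] k.
Proof.
rewrite (_ : k = fun h => `|h| `^ (- (1 + gamma))); last first.
  by apply/funext => h; rewrite /jump_kernel powRN.
exact: (measurableT_comp (measurable_powR (- (1 + gamma))) (@normr_measurable R setT)).
Qed.

Lemma levy_weight_ge0 h : 0 <= p h.
Proof. by rewrite mulr_ge0 ?jump_kernel_ge0// le_min sqr_ge0 ler01. Qed.

Lemma levy_weightN h : p (- h) = p h.
Proof. by rewrite /levy_weight sqrrN jump_kernelN. Qed.

Lemma measurable_levy_weight : measurable_fun [set: RR] p.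
Proof.
apply: measurable_funM; last exact: measurable_jump_kernel.
by apply: measurable_minr => //; exact: measurable_funX.
Qed.

Lemma levy_weight_le1 (h : R) : 0 < h -> p h <= h `^ ((2 - gamma) - 1).
Proof.
move=> h0; have -> : h `^ ((2 - gamma) - 1) = h ^+ 2 * k h.
  rewrite /k gtr0_norm// -powRN -powR_mulrn ?ltW// -powRD; last first.
    by rewrite (gt_eqF h0) implybT.
  by congr (_ `^ _); ring.
by rewrite ler_wpM2r ?jump_kernel_ge0// ge_min lexx.
Qed.

Lemma levy_weight_le2 (h : R) : 0 < h -> p h <= h `^ (- gamma - 1).
Proof.
move=> h0; have -> : h `^ (- gamma - 1) = 1 * k h.
  by rewrite mul1r /k gtr0_norm// -powRN; congr (_ `^ _); ring.
by rewrite ler_wpM2r ?jump_kernel_ge0// ge_min lexx orbT.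
Qed.

(** The integral over ]0, +oo[ is the limit of those over [1/n, n], which are
    bounded by 1/(2 - gamma) + 1/gamma by the fundamental theorem of calculus. *)
Lemma levy_weight_half : (\int[mu]_(h in `]0%R, +oo[) (p h)%:E < +oo)%E.
Proof.
have /andP[g0 g2] := gamma_in.
have mp : measurable_fun [set: RR] (EFin \o p).
  by apply/measurable_EFinP; exact: measurable_levy_weight.
(* starting at n + 2 makes 1 an interior point of every interval *)
pose E (n : nat) : set RR := `[(n.+2%:R)^-1, n.+2%:R]%classic.
have mE n : measurable (E n) by exact: measurable_itv.
have EU : `]0, +oo[%classic = \bigcup_n E n.
  apply/seteqP; split => [x /=|x [n _] /=]; rewrite !in_itv /= ?andbT.
    move=> x0; have [n xn] : exists n : nat, Num.max x x^-1 <= n%:R.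
      by exists (Num.bound (Num.max x x^-1)); rewrite ltW// archi_boundP// le_max ltW.
    move: xn; rewrite ge_max => /andP[x1 x2].
    have nn : n%:R <= n.+2%:R :> R by rewrite ler_nat -addn2 leq_addr.
    exists n => //; rewrite /E /= in_itv /= (le_trans x1)// andbT.
    by rewrite -[leRHS]invrK lef_pV2 ?posrE ?invr_gt0// (le_trans x2).
  rewrite /E /= in_itv /= => /andP[+ _]; apply: lt_le_trans; by rewrite invr_gt0.
rewrite EU.
have bnd n : (\int[mu]_(h in E n) (p h)%:E <= ((2 - gamma)^-1 + gamma^-1)%:E)%E.
  set x : R := (n.+2%:R)^-1; set y : R := n.+2%:R.
  have y1 : 1 < y by rewrite ltr1n.
  have y0 : 0 < y by exact: lt_trans y1.
  have x0 : 0 < x by rewrite invr_gt0.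
  have x1 : x < 1 by rewrite invf_lt1.
  have I1 : (\int[mu]_(h in `[x, 1%R]) (h `^ ((2 - gamma) - 1))%:E <= (2 - gamma)^-1%:E)%E.
    rewrite integral_powR//; last by rewrite gt_eqF// subr_gt0.
    rewrite lee_fin powR1 ler_piMl//; first by rewrite invr_ge0 subr_ge0 ltW.
    by rewrite lerBlDr lerDl powR_ge0.
  have I2 : (\int[mu]_(h in `[1%R, y]) (h `^ (- gamma - 1))%:E <= gamma^-1%:E)%E.
    rewrite integral_powR// ?oppr_eq0 ?gt_eqF//.
    rewrite lee_fin powR1 invrN mulrN -mulNr opprB ler_piMl//; first by rewrite invr_ge0 ltW.
    by rewrite lerBlDr lerDl powR_ge0.
  rewrite EFinD; apply: le_trans (leeD I1 I2).
  rewrite [leLHS]integral_mkcond [X in (_ <= X + _)%E]integral_mkcond.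
  rewrite [X in (_ <= _ + X)%E]integral_mkcond -ge0_integralD//; first last.
  - apply/(measurable_restrictT _ _).1 => //.
    by apply/measurable_EFinP/measurable_funTS; exact: measurable_powR.
  - by move=> h _; apply: erestrict_ge0 => t _; rewrite lee_fin powR_ge0.
  - apply/(measurable_restrictT _ _).1 => //.
    by apply/measurable_EFinP/measurable_funTS; exact: measurable_powR.
  - by move=> h _; apply: erestrict_ge0 => t _; rewrite lee_fin powR_ge0.
  apply: ge0_le_integral => //.
  - by move=> h _; apply: erestrict_ge0 => t _; rewrite lee_fin levy_weight_ge0.
  - exact: ((measurable_restrictT (fun h => (p h)%:E) (mE n)).1 (measurable_funTS mp)).
  - apply: emeasurable_funD; apply/(measurable_restrictT _ _).1 => //;
    by apply/measurable_EFinP/measurable_funTS; exact: measurable_powR.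
  move=> h _; rewrite !patchE !mem_setE !in_itv /=.
  case: ifPn => [/andP[xh hy]|_]; last first.
    by case: ifP => _; case: ifP => _; rewrite -?EFinD ?adde0 ?add0e lee_fin ?addr_ge0 ?powR_ge0.
  have h0 : 0 < h by exact: lt_le_trans xh.
  rewrite xh hy andbT /=; have [h1|h1] := leP h 1.
    apply: (@le_trans _ _ (h `^ (2 - gamma - 1))%:E); first by rewrite lee_fin levy_weight_le1.
    by case: ifP => _; rewrite ?adde0// -EFinD lee_fin lerDl powR_ge0.
  by rewrite (ltW h1) add0e lee_fin levy_weight_le2.
have Ecvg : (\int[mu]_(h in E n) (p h)%:E)%E @[n --> \oo] --> (\int[mu]_(h in \bigcup_n E n) (p h)%:E)%E.
  apply: ge0_nondecreasing_set_cvg_integral => //.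
  - apply/nondecreasing_seqP => n; rewrite subsetEset => x; rewrite /E /= !in_itv /= => /andP[a b].
    have le3 : n.+2%:R <= n.+3%:R :> R by rewrite ler_nat.
    rewrite (le_trans b)// andbT (le_trans _ a)// lef_pV2 ?posrE//.
  - by move=> n; exact: (measurable_funTS mp).
  - by move=> n x _; rewrite lee_fin levy_weight_ge0.
rewrite -(cvg_lim _ Ecvg)//; apply: le_lt_trans (ltry ((2 - gamma)^-1 + gamma^-1)).
apply: lime_le; first by apply/cvg_ex; eexists; exact: Ecvg.
by apply: nearW.
Qed.

Lemma integrable_levy_weight : mu.-integrable [set: RR] (EFin \o p).
Proof.
have mp := measurable_levy_weight.
pose q (h : R) : R := p h * \1_`]0, +oo[ h.
have mq : measurable_fun [set: RR] q by apply: measurable_funM => //; exact: measurable_indic.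
have iq : mu.-integrable [set: RR] (EFin \o q).
  apply/integrableP; split; first exact/measurable_EFinP.
  apply: le_lt_trans levy_weight_half.
  rewrite [leRHS]integral_mkcond; apply: ge0_le_integral => //.
  - by apply: measurableT_comp => //; exact/measurable_EFinP.
  - apply/(measurable_restrictT _ _).1 => //.
    by apply/measurable_EFinP/measurable_funTS.
  move=> h _; rewrite /= /q indicE patchE; case: (h \in _).
    by rewrite mulr1 ger0_norm// levy_weight_ge0.
  by rewrite mulr0 normr0.
have := integrableD measurableT iq (integrable_reflection 0 iq).
apply: (integrable_dominated (X := RR) (g := fun h => q h + q (0 - h))) => //.
move=> h; rewrite ger0_norm ?levy_weight_ge0// sub0r /q levy_weightN !indicE !mem_setE !in_itv /= !andbT.
have [h0|h0|<-] := ltgtP 0 h.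
- by rewrite mulr1 lerDl mulr_ge0// levy_weight_ge0.
- by rewrite oppr_gt0 h0 mulr1 mulr0 add0r.
- by rewrite /levy_weight expr0n /= min_l ?ler01// !mul0r addr0.
Qed.

End kernel.

(** * The fractional Laplacian of a bump function *)

Section fractional_laplacian_formula.
Context {R : realType}.
Local Notation mu := (@lebesgue_measure R).
Local Notation RR := (measurableTypeR R).
Variable gamma : R.
Hypothesis gamma_in : 0 < gamma < 2.
Local Notation k := (jump_kernel gamma).
Local Notation p := (levy_weight gamma).
Variables (zeta : R -> R) (M r C2 : R).
Hypothesis izeta : mu.-integrable [set: RR] (EFin \o zeta).
Hypothesis zeta_le : forall x, `|zeta x| <= M.
Hypothesis zeta_supp : forall x, r < `|x| -> zeta x = 0.
Hypothesis C2_ge0 : 0 <= C2.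
Hypothesis zeta_C2 : forall u h,
  `|zeta (u + h) + zeta (u - h) - 2 * zeta u| <= C2 * h ^+ 2.
Local Notation Theta := (second_difference k zeta).

Let K : R := C2 + 4 * M.

Let M_ge0 : 0 <= M. Proof. exact: le_trans (zeta_le 0). Qed.

Let mzeta : measurable_fun [set: RR] zeta.
Proof. by apply/measurable_EFinP; exact: (measurable_int _ izeta). Qed.

Let ip := integrable_levy_weight gamma_in.

Let p_ge0 := levy_weight_ge0 gamma.

Lemma second_difference_le u h : `|Theta u h| <= K * p h.
Proof.
rewrite /second_difference normrM (ger0_norm (jump_kernel_ge0 _ _)).
rewrite /levy_weight mulrA mulrC ler_wpM2r ?jump_kernel_ge0//.
have [h1|h1] := leP (h ^+ 2) 1.
  apply: le_trans (zeta_C2 u h) _; rewrite ler_wpM2r ?sqr_ge0//.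
  by rewrite /K; have := M_ge0; lra.
rewrite mulr1; have := zeta_le (u + h); have := zeta_le (u - h); have := zeta_le u.
rewrite !ler_norml => /andP[? ?] /andP[? ?] /andP[? ?].
by rewrite /K; have c0 := C2_ge0; apply/andP; split; lra.
Qed.

Lemma measurable_second_difference :
  measurable_fun [set: RR * RR] (fun z => Theta z.1 z.2).
Proof.
apply: measurable_funM.
  exact: (measurableT_comp (measurable_jump_kernel gamma) measurable_snd).
apply: measurable_funB; last first.
  by apply: measurable_funM => //; exact: (measurableT_comp mzeta measurable_fst).
apply: measurable_funD; first exact: (measurableT_comp mzeta measurable_add2).
exact: (measurableT_comp mzeta measurable_sub2).
Qed.

Lemma integrable_second_difference_h u : mu.-integrable [set: RR] (EFin \o Theta u).
Proof.
apply: (integrable_dominated (X := RR) (g := fun h => K * p h)).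
- exact: (measurableT_comp measurable_second_difference (measurable_pair1 u)).
- exact: second_difference_le.
- by have := ip; move/(integrableZl measurableT K); apply: eq_integrable.
Qed.

(** For |h| <= 1 the second difference is supported in [-(r + 1), r + 1]; for
    |h| > 1 the weight is the jump kernel itself, and the translates of zeta
    are kept.  The right-hand side is integrable in (u, h). *)
Let second_difference_bound u h : `|Theta u h| <=
  \1_`[- (r + 1), r + 1] u * (K * p h) + (p h * `|zeta (u + h)| + p h * `|zeta (u - h)|).
Proof.
rewrite indicE mem_setE in_itv /= -ler_norml.
have R0 : 0 <= p h * `|zeta (u + h)| + p h * `|zeta (u - h)|.
  by apply: addr_ge0; apply: mulr_ge0.
have [ur|ur] := leP `|u| (r + 1).
  by rewrite mul1r; apply: le_trans (second_difference_le u h) _; rewrite lerDl.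
have -> : Theta u h = k h * (zeta (u + h) + zeta (u - h)).
  by rewrite /second_difference [zeta u]zeta_supp ?mulr0 ?subr0//; lra.
rewrite mul0r add0r -mulrDr normrM (ger0_norm (jump_kernel_ge0 _ _)).
have [h1|h1] := leP `|h| 1.
  have Z x : `|u| <= `|x| + 1 -> zeta x = 0.
    by move=> ux; apply: zeta_supp; lra.
  rewrite !Z ?normr0 ?addr0 ?mulr0 ?normr0 ?mulr0//.
  - rewrite -{1}(subrK h u); apply: le_trans (ler_normD _ _) _; lra.
  - rewrite -{1}(addrK h u); apply: le_trans (ler_normB _ _) _; lra.
have -> : p h = k h.
  rewrite /levy_weight min_r ?mul1r// -real_normK ?num_real//.
  by rewrite expr_ge1// ltW.
by rewrite ler_wpM2l ?jump_kernel_ge0// ler_normD.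
Qed.

Let integrable_weight_translate (s : R) :
  (mu \x mu)%E.-integrable [set: RR * RR] (fun z => (p z.2 * `|zeta (z.1 + s * z.2)|)%:E).
Proof.
have mz : measurable_fun [set: RR] (fun x => `|zeta x|) by exact: measurableT_comp.
apply: (integrable_swapped (X := RR) (Y := RR) (f := fun h u => p h * `|zeta (u + s * h)|)).
apply: (integrable_prod (X := RR) (Y := RR) (f := fun h u => p h * `|zeta (u + s * h)|)).
  apply: measurable_funM.
    exact: (measurableT_comp (measurable_levy_weight gamma) measurable_fst).
  apply: (measurableT_comp mz); apply: measurable_funD; first exact: measurable_snd.
  by apply: measurable_funM => //; exact: measurable_fst.
have E h : (\int[mu]_u `|p h * `|zeta (u + s * h)%R| |%:E =
    (p h)%:E * \int[mu]_u `|zeta u|%:E)%E.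
  under eq_integral do rewrite normrM normr_id (ger0_norm (p_ge0 _)) EFinM.
  rewrite ge0_integralZl_EFin//; last first.
    by apply/measurable_EFinP; exact: (measurableT_comp mz (measurable_translation (s * h))).
  congr (_ * _)%E.
  rewrite (integral_translation (s * h) (f := fun u => `|zeta u|%:E))//.
  exact/measurable_EFinP.
under eq_integral do rewrite E.
rewrite ge0_integralZr//; last 3 first.
- by apply/measurable_EFinP; exact: measurable_levy_weight.
- by move=> h _; rewrite lee_fin.
- exact: integral_ge0.
apply: lte_mul_pinfty => //.
- by apply: integral_ge0 => h _; rewrite lee_fin.
- exact: (integrable_fin_num measurableT ip).
- exact: (integrable_lty measurableT (integrable_norm izeta)).
Qed.

Lemma integrable_second_difference :
  (mu \x mu)%E.-integrable [set: RR * RR] (fun z => (Theta z.1 z.2)%:E).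
Proof.
apply: (integrable_dominated (X := (RR * RR)%type)
  (f := fun z : RR * RR => Theta z.1 z.2)
  (g := fun z => \1_`[- (r + 1), r + 1] z.1 * (K * p z.2) +
    (p z.2 * `|zeta (z.1 + 1 * z.2)| + p z.2 * `|zeta (z.1 + (- 1) * z.2)|))).
- exact: measurable_second_difference.
- by move=> z; rewrite mul1r mulN1r; exact: second_difference_bound.
have iKp : mu.-integrable [set: RR] (EFin \o (fun h => K * p h)).
  by have := ip; move/(integrableZl measurableT K); apply: eq_integrable.
have := integrableD measurableT
  (integrable_tensor (integrable_indic_itvR (- (r + 1)) (r + 1)) iKp)
  (integrableD measurableT (integrable_weight_translate 1) (integrable_weight_translate (- 1))).
exact: eq_integrable.
Qed.

(** The indicator of the steps of length at least eps. *)
Let far (eps h : R) : R := \1_[set h' : R | eps <= `|h'|] h.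

Let farE eps h : far eps h = (eps <= `|h|)%R%:R.
Proof.
rewrite /far indicE; case: (boolP (eps <= `|h|)) => eh; first by rewrite mem_set.
by rewrite memNset//=; exact/negP.
Qed.

Let mfar eps : measurable_fun [set: RR] (far eps).
Proof.
apply: measurable_indic.
rewrite (_ : [set h' : R | _] = Num.norm @^-1` `[eps, +oo[%classic); last first.
  by apply/seteqP; split => x /=; rewrite in_itv /= andbT.
rewrite -[X in measurable X]setTI.
by apply: (@normr_measurable R setT).
Qed.

Let jump_kernel_far eps h : 0 < eps -> far eps h * k h <= (Num.min (eps ^+ 2) 1)^-1 * p h.
Proof.
move=> e0; have m0 : 0 < Num.min (eps ^+ 2) 1 by rewrite lt_min ltr01 andbT exprn_gt0.
rewrite /levy_weight mulrA ler_wpM2r ?jump_kernel_ge0// farE ler_pdivlMl//.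
case: (boolP (eps <= `|h|)) => eh; last first.
  by rewrite mulr0 le_min sqr_ge0 ler01.
rewrite mulr1 le_min !ge_min lexx orbT andbT.
apply/orP; left; rewrite -[leRHS]real_normK ?num_real//.
by rewrite lerXn2r ?nnegrE// ltW.
Qed.

(** Averaging over h and -h turns the first differences of the truncated integral
    into second differences, which need no truncation in the limit. *)
Let truncated (a eps : R) : 0 < eps ->
  \int[mu]_h (far eps h * (k h * (zeta (a + h) - zeta a))) =
  2^-1 * \int[mu]_h (far eps h * Theta a h).
Proof.
move=> e0; pose phi h := far eps h * (k h * (zeta (a + h) - zeta a)).
have mphi : measurable_fun [set: RR] phi.
  apply: measurable_funM => //; apply: measurable_funM; first exact: measurable_jump_kernel.
  apply: measurable_funB => //; apply: (measurableT_comp mzeta).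
  by apply: measurable_funD.
have iphi : mu.-integrable [set: RR] (EFin \o phi).
  apply: (integrable_dominated (X := RR)
    (g := fun h => (2 * M * (Num.min (eps ^+ 2) 1)^-1) * p h)) => //.
    move=> h; rewrite /phi mulrA normrM mulrC -mulrA.
    apply: ler_pM => //.
      have := zeta_le (a + h); have := zeta_le a; rewrite !ler_norml.
      by move=> /andP[? ?] /andP[? ?]; apply/andP; split; lra.
    rewrite ger0_norm ?jump_kernel_far// mulr_ge0 ?jump_kernel_ge0//.
  have := ip; move/(integrableZl measurableT (2 * M * (Num.min (eps ^+ 2) 1)^-1)).
  exact: eq_integrable.
have E : \int[mu]_h phi (0 - h) = \int[mu]_h phi h by exact: Rintegral_reflection.
have -> : \int[mu]_h phi h = 2^-1 * (\int[mu]_h phi h + \int[mu]_h phi (0 - h)).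
  by rewrite E; lra.
rewrite -(RintegralD measurableT iphi (integrable_reflection 0 iphi)).
congr (_ * _); apply: eq_Rintegral => h _.
rewrite sub0r /phi /second_difference jump_kernelN.
have -> : far eps (- h) = far eps h by rewrite !farE normrN.
by ring.
Qed.

Let truncated_cvg (a : R) :
  \int[mu]_h (far eps h * Theta a h) @[eps --> 0^'+] --> \int[mu]_h Theta a h.
Proof.
have iT := integrable_second_difference_h a.
have /measurable_EFinP mT := measurable_int _ iT.
apply/cvg_at_rightP => u [u0 ucvg].
have [] := @dominated_convergence _ RR R mu setT measurableT
  (fun n h => (far (u n) h * Theta a h)%:E) (fun h => (Theta a h)%:E)
  (fun h => `|Theta a h|%:E).
- by move=> n; apply/measurable_EFinP; exact: measurable_funM.
- exact: (measurable_int _ iT).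
- apply: aeW => h _.
  have [->|h0] := eqVneq h 0.
    have T0 : Theta a 0 = 0.
      rewrite /second_difference /jump_kernel normr0 powR0 ?invr0 ?mul0r//.
      by have /andP[g0 _] := gamma_in; rewrite gt_eqF// addr_gt0.
    by under eq_fun do rewrite T0 mulr0; rewrite T0; exact: cvg_cst.
  apply: cvg_near_cst.
  have : \forall n \near \oo, u n < `|h|.
    by move/cvgrPdist_lt : ucvg => /(_ `|h|); rewrite normr_gt0 => /(_ h0);
    apply: filterS => n; rewrite sub0r normrN gtr0_norm.
  apply: filterS => n unh; congr EFin.
  by rewrite farE ltW// mul1r.
- exact: (integrable_norm iT).
- apply: aeW => h n _; rewrite /= lee_fin normrM ler_piMl//.
  by rewrite farE; case: (u n <= `|h|); rewrite ?normr1 ?normr0.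
move=> _ _ H; rewrite /Rintegral.
apply: (@fine_cvg _ _ _ _ (fun n => \int[mu]_x (far (u n) x * Theta a x)%:E)%E).
by rewrite fineK//; exact: (integrable_fin_num measurableT iT).
Qed.

(** The principal value that defines the fractional Laplacian of zeta(x - .) is
    an absolutely convergent integral of second differences. *)
Lemma fractional_laplacian_reflected (x u : R) :
  fractional_laplacian gamma (fun v => zeta (x - v)) u =
  jump_constant gamma / 2 * \int[mu]_h Theta (x - u) h.
Proof.
rewrite /fractional_laplacian -mulrA; congr (_ * _).
apply: cvg_lim => //.
apply: (@cvg_trans _ (2^-1 * \int[mu]_h (far eps h * Theta (x - u) h) @[eps --> 0^'+])); last first.
  by apply: cvgMr; exact: truncated_cvg.
apply: near_eq_cvg; near=> eps.
have e0 : 0 < eps by near: eps; exact: nbhs_right_gt.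
rewrite -truncated// -(Rintegral_reflection u).
  apply: eq_Rintegral => v _; rewrite (_ : x - u + (u - v) = x - v); last by ring.
  by rewrite [_ / _]mulrC /far !indicE.
apply: measurable_funM => //; apply: measurable_funM; first exact: measurable_jump_kernel.
apply: measurable_funB => //; apply: (measurableT_comp mzeta).
by apply: measurable_funD.
Unshelve. all: by end_near. Qed.

End fractional_laplacian_formula.

(** * Removing the mollifier at Lebesgue points *)

Section mollification_limit.
Context {R : realType}.
Local Notation mu := (@lebesgue_measure R).
Local Notation RR := (measurableTypeR R).

Lemma sqre_poweR (e : \bar R) : (0 <= e)%E -> (e ^+ 2 = e `^ 2)%E.
Proof.
case: e => [x| |//]; last by move=> _; rewrite poweRyr//.
rewrite lee_fin => x0; rewrite poweR_EFin -EFin_expe; congr EFin.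
by rewrite powR_mulrn.
Qed.

Lemma sqr_L2_norm (f : R -> R) : (L2_norm f ^+ 2 = \int[mu]_x (f x ^+ 2)%:E)%E.
Proof.
rewrite sqre_poweR; last exact: Lnorm_ge0.
rewrite poweR_Lnorm; last by rewrite pnatr_eq0.
apply: eq_integral => x _; rewrite -sqre_poweR// -EFin_expe.
by rewrite real_normK ?num_real.
Qed.

(** The mollification error at x is controlled by the mean oscillation of f
    around f(x) on the ball of radius r, because the mollifier is at most
    exp(4) / r on this ball of measure 2 r. *)
Lemma mollifier_davg (f : R -> R) (x r : R) : 0 < r ->
  measurable_fun [set: RR] f -> (forall y, `|f y| <= 1) ->
  (`|convolution (mollifier r) f x - f x|%:E <= (2 * expR 4)%:E * davg f x r)%E.
Proof.
move=> r0 mf f1; set z := mollifier r.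
have iz := integrable_mollifier r0.
have if1 := integrable_convolution_integrand iz x mf f1.
have izx := integrable_reflection x iz.
have mz : measurable_fun [set: RR] z by apply/measurable_EFinP; exact: (measurable_int _ iz).
have mzx : measurable_fun [set: RR] (fun y => z (x - y)).
  exact: (measurableT_comp mz (measurable_reflection x)).
have ifx : mu.-integrable [set: RR] (EFin \o (fun y => f x * z (x - y))).
  by have := izx; move/(integrableZl measurableT (f x)); apply: eq_integrable.
have -> : convolution z f x - f x = \int[mu]_y (f y * z (x - y) - f x * z (x - y)).
  rewrite (RintegralB measurableT if1 ifx) (RintegralZl (f x) measurableT izx).
  by rewrite (Rintegral_reflection x mz) (mollifier_mass r0) mulr1.
have mfx : measurable_fun [set: RR] (fun y => `|f y - f x|).
  by apply: measurableT_comp => //; exact: measurable_funB.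
apply: le_trans (abse_Rintegral_le _ _) _.
  by apply: measurable_funB; apply: measurable_funM.
have mabs : measurable_fun [set: RR] (fun y => `|((center (f x) \o f) y)%:E|%E).
  by apply: measurableT_comp => //; apply/measurable_EFinP; exact: measurable_funB.
have mres := (measurable_restrictT _ (measurable_ball x r)).1 (measurable_funTS mabs).
rewrite /davg /iavg lebesgue_measure_ball; last exact: ltW.
have r20 : r *+ 2 != 0 by rewrite mulrn_eq0 /= gt_eqF.
rewrite inver (negbTE r20) muleA -EFinM.
rewrite [X in (_ <= X * _)%E](_ : _ = (expR 4 / r)%:E); last first.
  by congr EFin; rewrite -mulr_natr; field; rewrite gt_eqF.
rewrite [X in (_ <= _ * X)%E]integral_mkcond -ge0_integralZl_EFin//; first last.
- by rewrite divr_ge0 ?expR_ge0// ltW.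
- by move=> y _; apply: erestrict_ge0 => t _; rewrite lee_fin.
apply: ge0_le_integral => //.
- by apply/measurable_EFinP; apply: measurableT_comp => //; apply: measurable_funB; apply: measurable_funM.
- exact: (measurable_funeM _ mres).
move=> y _; rewrite patchE -mulrBl normrM (ger0_norm (mollifier_ge0 r0 _)).
case: ifPn => yb.
  by rewrite -EFinM lee_fin mulrC ler_wpM2r// mollifier_le.
rewrite mule0 lee_fin mollifier_supp ?mulr0//.
by move: yb; apply: contraNT; rewrite -ltNge => xy; rewrite inE.
Qed.

Lemma mollifier_cvg (f : R -> R) (x : R) :
  measurable_fun [set: RR] f -> (forall y, `|f y| <= 1) -> lebesgue_pt f x ->
  convolution (mollifier n.+1%:R^-1) f x @[n --> \oo] --> f x.
Proof.
move=> mf f1 fx.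
have r0 n : 0 < n.+1%:R^-1 :> R by rewrite invr_gt0.
have rcvg : (n.+1%:R^-1 : R) @[n --> \oo] --> (0 : R)^'+.
  move=> A A0; have : \forall n \near \oo, 0 < (n.+1%:R^-1 : R) -> A n.+1%:R^-1.
    exact: (@cvg_harmonic R _ A0).
  by apply: filterS => n; apply.
have /fine_cvgP[dfin dcvg] : davg f x n.+1%:R^-1 @[n --> \oo] --> 0%E.
  exact: (cvg_comp _ _ rcvg fx).
apply/cvgrPdist_le => e e0; have K0 : 0 < 2 * expR 4 :> R by rewrite mulr_gt0// expR_gt0.
have := dcvg; move/cvgrPdist_le => /(_ (e / (2 * expR 4))); rewrite divr_gt0// => /(_ isT) dle.
near=> n.
have dn : davg f x n.+1%:R^-1 \is a fin_num by near: n; exact: dfin.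
have : `|0 - fine (davg f x n.+1%:R^-1)| <= e / (2 * expR 4) by near: n; exact: dle.
rewrite sub0r normrN ler_pdivlMr// => H.
have := mollifier_davg x (r0 n) mf f1; rewrite -(fineK dn) -EFinM lee_fin distrC => H2.
apply: le_trans H2 _; rewrite mulrC; apply: le_trans H; rewrite ler_wpM2r ?ler_norm//.
Unshelve. all: by end_near. Qed.

End mollification_limit.

(** * The mollified weak equation *)

Section time_clipping.
Context {R : realType}.
Local Notation mu := (@lebesgue_measure R).
Local Notation RR := (measurableTypeR R).
Variable T : R.

(** The function f extended by 0 to times outside [0, T]. *)
Definition clip (f : R -> R -> R) (t x : R) : R := if 0 <= t <= T then f t x else 0.

Lemma clip_in f t x : 0 <= t <= T -> clip f t x = f t x.
Proof. by rewrite /clip => ->. Qed.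

Lemma clip_out f t x : ~~ (0 <= t <= T) -> clip f t x = 0.
Proof. by rewrite /clip => /negbTE ->. Qed.

Lemma measurable_clip f :
  measurable_fun (`[0, T] `*` [set: R])
    (fun z : measurableTypeR R * measurableTypeR R => f z.1 z.2) ->
  measurable_fun [set: RR * RR] (fun z => clip f z.1 z.2).
Proof.
have mD : measurable (`[0, T] `*` [set: R] : set (RR * RR)) by apply: measurableX.
move=> /(measurable_restrictT _ mD); apply: eq_measurable_fun => z _.
rewrite /clip patchE; have [zT|zT] := boolP (0 <= z.1 <= T).
  by rewrite mem_set//=; split => //; rewrite in_itv.
by rewrite memNset//= => -[]; rewrite in_itv /= (negbTE zT).
Qed.

Lemma integral_clip (h : R -> R -> R) :
  (\int[mu]_t \int[mu]_x (clip h t x ^+ 2)%:E =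
   \int[mu]_(t in `[0%R, T]) \int[mu]_x (h t x ^+ 2)%:E)%E.
Proof.
rewrite [RHS]integral_mkcond; apply: eq_integral => t _.
rewrite patchE mem_setE in_itv /= /clip; case: ifP => // _.
by under eq_integral do rewrite expr0n; rewrite integral0.
Qed.

Lemma L2_time_clip (h : R -> R -> R) : L2_time T L2 L2_norm h ->
  measurable_fun [set: RR * RR] (fun z => clip h z.1 z.2) /\
  (\int[mu]_t \int[mu]_x (clip h t x ^+ 2)%:E < +oo)%E.
Proof.
move=> [mh _ hfin]; split; first exact: measurable_clip.
by rewrite integral_clip; under eq_integral do rewrite -sqr_L2_norm.
Qed.

Lemma clip_shift (rho : R -> R -> R) (b : R) :
  measurable_fun [set: RR * RR] (fun z => clip (fun t x => rho t x - b) z.1 z.2) ->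
  measurable_fun [set: RR * RR] (fun z => clip rho z.1 z.2).
Proof.
move=> mh.
rewrite (_ : (fun z => _) = (fun z : RR * RR =>
    clip (fun t x => rho t x - b) z.1 z.2 + \1_`[0, T] z.1 * b)); last first.
  apply/funext => z; rewrite indicE mem_setE in_itv /= /clip.
  by case: (0 <= z.1 <= T); rewrite ?mul1r ?mul0r ?subrK ?addr0.
apply: measurable_funD => //; apply: measurable_funM => //.
by apply: (measurableT_comp _ measurable_fst); exact: measurable_indic.
Qed.

End time_clipping.

Section mollified_weak_equation.
Context {R : realType}.
Local Notation mu := (@lebesgue_measure R).
Local Notation RR := (measurableTypeR R).
Variables (gamma T : R) (m : nat) (g : R -> R).
Hypothesis gamma_in : 0 < gamma < 2.
Hypothesis m_gt0 : (0 < m)%N.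
Variable r : R.
Hypothesis r_gt0 : 0 < r.
Local Notation zeta := (mollifier r).
Local Notation Theta := (second_difference (jump_kernel gamma) zeta).

Let zeta_le x : `|zeta x| <= expR 4 / r.
Proof. by rewrite ger0_norm ?mollifier_ge0// mollifier_le. Qed.

Let zeta_supp x : r < `|x| -> zeta x = 0.
Proof. by move=> xr; rewrite mollifier_supp// ltW. Qed.

Let izeta := integrable_mollifier r_gt0.

Let zeta_C2 : exists2 C : R, 0 <= C & forall u h,
  `|zeta (u + h) + zeta (u - h) - 2 * zeta u| <= C * h ^+ 2.
Proof.
exact: (flat_algebra_second_difference (mollifier_flat_algebra r) zeta_le zeta_supp).
Qed.

(** Up to the factor [jump_constant gamma / 2], the fractional Laplacian of the
    mollifier. *)
Definition mollified_laplacian (u : R) : R := \int[mu]_h Theta u h.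
Local Notation N0 := mollified_laplacian.

Lemma integrable_mollified_laplacian : mu.-integrable [set: RR] (EFin \o N0).
Proof.
have [C2 C20 HC2] := zeta_C2.
apply: (integrable_Rintegral (X := RR) (Y := RR) (f := Theta)).
exact: (integrable_second_difference gamma_in izeta zeta_le zeta_supp C20 HC2).
Qed.

Lemma fractional_laplacian_mollifier x u :
  fractional_laplacian gamma (fun v => zeta (x - v)) u =
  jump_constant gamma / 2 * N0 (x - u).
Proof.
have [C2 C20 HC2] := zeta_C2.
exact: (fractional_laplacian_reflected gamma_in izeta zeta_le C20 HC2).
Qed.

Lemma test_functions_mollifier x : test_functions (fun _ u => zeta (x - u)).
Proof.
exists 0%N, (fun _ u => zeta (x - u)); split.
  move=> _; apply: (@flat_algebra_Ccinfty R _ (x - r) (x + r)).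
    exact: mollifier_flat_algebra_reflection.
  move=> u xu; apply: mollifier_supp => //; move: xu; apply: contraNle.
  by rewrite ltr_norml => /andP[? ?]; apply/andP; split; lra.
by apply/funext => t; apply/funext => u; rewrite big_ord1 expr0 mul1r.
Qed.

Variable rho : R -> R -> R.
Hypothesis mrho : measurable_fun [set: RR * RR] (fun z => clip T rho z.1 z.2).
Hypothesis rho_range : forall t u, t \in `[0, T] -> 0 <= rho t u <= 1.
Hypothesis weak : forall t G, t \in `[0, T] -> test_functions G ->
  weak_F gamma m t rho G g = 0.

Let rc := clip T rho.

Lemma clip_range t x : 0 <= clip T rho t x <= 1.
Proof.
by rewrite /clip; case: ifP => [tT|_]; [apply: rho_range; rewrite in_itv|rewrite lexx ler01].
Qed.

Let rcm_le t x : `|rc t x ^+ m| <= 1.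
Proof.
have /andP[r0 r1] := clip_range t x.
by rewrite ger0_norm ?exprn_ge0// exprn_ile1.
Qed.

Let mrcm : measurable_fun [set: RR * RR] (fun z => rc z.1 z.2 ^+ m).
Proof. exact: measurable_funX. Qed.

Lemma integrable_convolution_power x :
  mu.-integrable [set: RR] (EFin \o (fun s => convolution N0 (fun y => rc s y ^+ m) x)).
Proof.
have iN := integrable_mollified_laplacian.
apply: (@integrable_supported R T _ (\int[mu]_y `|N0 y|)).
- apply: (measurable_convolution (X := RR) iN (f := fun s y => rc s y ^+ m) (p := fun=> x)) => //.
- move=> s; apply: convolution_bounded => //.
  exact: (measurableT_comp mrcm (measurable_pair1 s)).
- move=> s sT; rewrite /convolution.
  under eq_Rintegral do rewrite /rc clip_out// expr0n eqn0Ngt m_gt0 mul0r.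
  by rewrite /Rintegral integral0.
Qed.

(** The weak equation tested with the function zeta(x - .), constant in time. *)
Lemma mollified_weak_equation t x : 0 <= t <= T ->
  convolution zeta (rc t) x = inner g (fun u => zeta (x - u)) +
  jump_constant gamma / 2 *
    \int[mu]_(s in `[0, t]) convolution N0 (fun y => rc s y ^+ m) x.
Proof.
move=> tT; have tT' : t \in `[0, T] by rewrite in_itv.
have := weak tT' (test_functions_mollifier x); rewrite /weak_F.
have -> : inner (rho t) (fun u => zeta (x - u)) = convolution zeta (rc t) x.
  by apply: eq_Rintegral => y _; rewrite /rc clip_in.
have -> : \int[mu]_(s in `[0, t]) inner (rho s) (time_derivative (fun _ u => zeta (x - u)) s) = 0.
  have H s : inner (rho s) (time_derivative (fun _ u => zeta (x - u)) s) = 0.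
    rewrite /inner /time_derivative.
    under eq_Rintegral do rewrite derive1_cst mulr0.
    by rewrite /Rintegral integral0.
  by under eq_Rintegral do rewrite H; rewrite /Rintegral integral0.
have -> : \int[mu]_(s in `[0, t]) inner (fun u => rho s u ^+ m)
      (fractional_laplacian gamma (fun u => zeta (x - u))) =
    jump_constant gamma / 2 *
    \int[mu]_(s in `[0, t]) convolution N0 (fun y => rc s y ^+ m) x.
  rewrite -RintegralZl//; last first.
    by apply: (integrableS _ _ _ (integrable_convolution_power x)).
  apply: eq_Rintegral => s; rewrite inE /= in_itv /= => /andP[s0 st].
  have sT : 0 <= s <= T by rewrite s0 (le_trans st)//; case/andP: tT.
  have ms : measurable_fun [set: RR] (fun y => rc s y ^+ m).
    exact: (measurableT_comp mrcm (measurable_pair1 s)).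
  rewrite /convolution -RintegralZl//; last first.
    exact: (integrable_convolution_integrand integrable_mollified_laplacian x ms (rcm_le s)).
  apply: eq_Rintegral => y _; rewrite fractional_laplacian_mollifier /rc clip_in//.
  by rewrite mulrCA.
by rewrite subr0 => /eqP; rewrite subr_eq0 subr_eq addrC => /eqP ->.
Qed.

End mollified_weak_equation.

(** * Passage to the limit *)

Section fatou_bounds.
Local Open Scope ereal_scope.

Lemma measurable_limn_einf d (X : measurableType d) (R : realType)
    (f : nat -> X -> \bar R) : (forall n, measurable_fun [set: X] (f n)) ->
  measurable_fun [set: X] (fun x => limn_einf (f^~ x)).
Proof.
move=> mf.
rewrite (_ : (fun x => _) = (fun x => - limn_esup (fun n => - f n x))).
  by apply: measurableT_comp => //; apply: measurable_fun_limn_esup => // n; exact: measurableT_comp.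
by apply/funext => x; rewrite (limn_esupN (f^~ x)) oppeK.
Qed.

Lemma limn_einf_le (R : realType) (u : nat -> \bar R) (c : \bar R) :
  (forall n, u n <= c) -> limn_einf u <= c.
Proof.
move=> uc; rewrite limn_einf_lim; apply: lime_le; first exact: is_cvg_einfs.
by apply: nearW => n; apply: le_trans (uc n); apply: ereal_inf_lbound; exists n => /=.
Qed.

(** Fatou's lemma with an almost everywhere limit. *)
Lemma fatou_ae d (X : measurableType d) (R : realType) (m : {measure set X -> \bar R})
    (f : nat -> X -> \bar R) (h : X -> \bar R) :
  (forall n, measurable_fun [set: X] (f n)) -> (forall n x, 0 <= f n x) ->
  measurable_fun [set: X] h -> (forall x, 0 <= h x) ->
  {ae m, forall x, f n x @[n --> \oo] --> h x} ->
  \int[m]_x h x <= limn_einf (fun n => \int[m]_x f n x).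
Proof.
move=> mf f0 mh h0 fh; apply: le_trans (fatou m measurableT mf (fun n x _ => f0 n x)).
rewrite (@ae_eq_integral _ _ _ m setT (fun x => limn_einf (f^~ x)) h)//.
- exact: measurable_limn_einf.
- by apply: filterS fh => x /cvg_limn_einf_sup[-> _].
Qed.

End fatou_bounds.

Section mollified_product.
Context {R : realType}.
Local Notation mu := (@lebesgue_measure R).
Local Notation RR := (measurableTypeR R).
Variables (w W : R -> R -> R).
Hypothesis mw : measurable_fun [set: RR * RR] (fun z => w z.1 z.2).
Hypothesis mW : measurable_fun [set: RR * RR] (fun z => W z.1 z.2).
Hypothesis w_le : forall t x, `|w t x| <= 1.
Hypothesis W_le : forall t x, `|W t x| <= 1.
Hypothesis w_L2 : (\int[mu]_t \int[mu]_x (w t x ^+ 2)%:E < +oo)%E.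
Hypothesis W_L2 : (\int[mu]_t \int[mu]_x (W t x ^+ 2)%:E < +oo)%E.
Local Notation zeta n := (mollifier (n.+1%:R^-1)).
Hypothesis energy : forall n, \int[(mu \x mu)%E]_z
  (convolution (zeta n) (w z.1) z.2 * convolution (zeta n) (W z.1) z.2) <= 0.

Let r0 n : 0 < n.+1%:R^-1 :> R. Proof. by rewrite invr_gt0. Qed.

Let izeta n := integrable_mollifier (r0 n).

Let mol (f : R -> R -> R) n t x := convolution (zeta n) (f t) x.

Let zeta_norm n : (\int[mu]_x `|zeta n x|%:E = 1)%E.
Proof.
under eq_integral do rewrite ger0_norm ?(mollifier_ge0 (r0 n))//.
by rewrite -(EFin_Rintegral (izeta n)) (mollifier_mass (r0 n)).
Qed.

Let mol_L2 (f : R -> R -> R) n : measurable_fun [set: RR * RR] (fun z => f z.1 z.2) ->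
  (\int[mu]_t \int[mu]_x (mol f n t x ^+ 2)%:E <= \int[mu]_t \int[mu]_x (f t x ^+ 2)%:E)%E.
Proof.
by move=> mf; apply: le_trans (convolution_time_L2 mf (izeta n)) _; rewrite zeta_norm !mul1e.
Qed.

Let mmol (f : R -> R -> R) n : measurable_fun [set: RR * RR] (fun z => f z.1 z.2) ->
  measurable_fun [set: RR * RR] (fun z => mol f n z.1 z.2).
Proof. by move=> mf; exact: (measurable_convolution_time mf (izeta n)). Qed.

Let iter_plane (f : R -> R -> R) : measurable_fun [set: RR * RR] (fun z => f z.1 z.2) ->
  (\int[mu]_t \int[mu]_x (f t x ^+ 2)%:E = \int[(mu \x mu)%E]_z (f z.1 z.2 ^+ 2)%:E)%E.
Proof.
move=> mf; rewrite (@fubini_tonelli1 _ _ RR RR _ mu mu (fun z => (f z.1 z.2 ^+ 2)%:E))//.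
- by apply/measurable_EFinP; exact: measurable_funX.
- by move=> z; rewrite lee_fin sqr_ge0.
Qed.

(** Expanding the square, the cross term is at most 0 by the energy inequality,
    and mollification does not increase the L^2 norm. *)
Let sum_bound n :
  (\int[mu]_t \int[mu]_x ((mol w n t x + mol W n t x) ^+ 2)%:E <=
   \int[mu]_t \int[mu]_x (w t x ^+ 2)%:E + \int[mu]_t \int[mu]_x (W t x ^+ 2)%:E)%E.
Proof.
have ma := mmol n mw; have mb := mmol n mW.
have ia := integrable_sqr_time_space ma (le_lt_trans (mol_L2 n mw) w_L2).
have ib := integrable_sqr_time_space mb (le_lt_trans (mol_L2 n mW) W_L2).
have iab2 : (mu \x mu)%E.-integrable [set: RR * RR]
    (EFin \o (fun z => mol w n z.1 z.2 ^+ 2 + mol W n z.1 z.2 ^+ 2)).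
  by have := integrableD measurableT ia ib; apply: eq_integrable.
have iab : (mu \x mu)%E.-integrable [set: RR * RR]
    (EFin \o (fun z => mol w n z.1 z.2 * mol W n z.1 z.2)).
  apply: (integrable_dominated (X := (RR * RR)%type) _ _ iab2); first exact: measurable_funM.
  move=> z; rewrite ler_norml.
  have := sqr_ge0 (mol w n z.1 z.2 - mol W n z.1 z.2).
  have := sqr_ge0 (mol w n z.1 z.2 + mol W n z.1 z.2).
  move: (mol w n z.1 z.2) (mol W n z.1 z.2) => a b; nra.
have i2ab : (mu \x mu)%E.-integrable [set: RR * RR]
    (EFin \o (fun z => 2 * (mol w n z.1 z.2 * mol W n z.1 z.2))).
  by have := iab; move/(integrableZl measurableT 2); apply: eq_integrable.
have isum : (mu \x mu)%E.-integrable [set: RR * RR]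
    (EFin \o (fun z => (mol w n z.1 z.2 + mol W n z.1 z.2) ^+ 2)).
  have := integrableD measurableT iab2 i2ab; apply: eq_integrable => // z _ /=.
  by rewrite -EFinD; congr EFin; ring.
apply: (@le_trans _ _ (\int[mu]_t \int[mu]_x (mol w n t x ^+ 2)%:E +
    \int[mu]_t \int[mu]_x (mol W n t x ^+ 2)%:E)%E); last by apply: leeD; exact: mol_L2.
rewrite (iter_plane (f := fun t x => mol w n t x + mol W n t x)); last exact: measurable_funD.
rewrite (iter_plane ma) (iter_plane mb).
rewrite -(EFin_Rintegral isum) -(EFin_Rintegral ia) -(EFin_Rintegral ib) -EFinD lee_fin.
rewrite -(RintegralD measurableT ia ib).
have -> : \int[(mu \x mu)%E]_z ((mol w n z.1 z.2 + mol W n z.1 z.2) ^+ 2) =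
    \int[(mu \x mu)%E]_z (mol w n z.1 z.2 ^+ 2 + mol W n z.1 z.2 ^+ 2) +
    2 * \int[(mu \x mu)%E]_z (mol w n z.1 z.2 * mol W n z.1 z.2).
  rewrite -(RintegralZl 2 measurableT iab) -(RintegralD measurableT iab2 i2ab).
  by apply: eq_Rintegral => z _; ring.
by rewrite gerDl mulr_ge0_le0//; exact: energy.
Qed.

Let mol_cvg (f : R -> R -> R) (t : R) : measurable_fun [set: RR * RR] (fun z => f z.1 z.2) ->
  (forall t x, `|f t x| <= 1) ->
  {ae mu, forall x, mol f n t x @[n --> \oo] --> f t x}.
Proof.
move=> mf f1; have mft : measurable_fun [set: RR] (f t).
  exact: (measurableT_comp mf (measurable_pair1 t)).
have loc : locally_integrable [set: R] (f t).
  split => //; first exact: openT.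
  move=> K _ cK; apply: (@le_lt_trans _ _ (\int[mu]_(x in K) (1%:E))%E).
    apply: ge0_le_integral => //.
    - exact: compact_measurable.
    - by apply/measurable_EFinP; apply: measurableT_comp => //; exact: measurable_funTS.
    - by move=> x _; rewrite lee_fin.
  rewrite integral_cst ?mul1e; last exact: compact_measurable.
  exact: compact_finite_measure.
have Fae := ae_filter_ringOfSetsType mu.
have := lebesgue_differentiation loc; apply: filterS => x fx.
exact: mollifier_cvg.
Qed.

(** Fatou's lemma is applied first in x for each t, where almost every x is a
    Lebesgue point, and then in t. *)
Lemma sum_sqr_le :
  (\int[mu]_t \int[mu]_x ((w t x + W t x) ^+ 2)%:E <=
   \int[mu]_t \int[mu]_x (w t x ^+ 2)%:E + \int[mu]_t \int[mu]_x (W t x ^+ 2)%:E)%E.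
Proof.
have mI (f h : R -> R -> R) : measurable_fun [set: RR * RR] (fun z => f z.1 z.2) ->
    measurable_fun [set: RR * RR] (fun z => h z.1 z.2) ->
    measurable_fun [set: RR] (fun t => \int[mu]_x ((f t x + h t x) ^+ 2)%:E)%E.
  move=> mf mh.
  apply: (@measurable_fun_fubini_tonelli_F _ _ RR RR _ mu
    (fun z => ((f z.1 z.2 + h z.1 z.2) ^+ 2)%:E)).
  - by apply/measurable_EFinP; apply: measurable_funX; exact: measurable_funD.
  - by move=> z; rewrite lee_fin sqr_ge0.
have mS (f h : R -> R -> R) t : measurable_fun [set: RR * RR] (fun z => f z.1 z.2) ->
    measurable_fun [set: RR * RR] (fun z => h z.1 z.2) ->
    measurable_fun [set: RR] (fun x => ((f t x + h t x) ^+ 2)%:E).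
  move=> mf mh; apply/measurable_EFinP; apply: measurable_funX; apply: measurable_funD.
  - exact: (measurableT_comp mf (measurable_pair1 t)).
  - exact: (measurableT_comp mh (measurable_pair1 t)).
have I0 (f : R -> R -> R) t : (0 <= \int[mu]_x (f t x ^+ 2)%:E)%E.
  by apply: integral_ge0 => x _; rewrite lee_fin sqr_ge0.
pose g n t := (\int[mu]_x ((mol w n t x + mol W n t x) ^+ 2)%:E)%E.
have mg n : measurable_fun [set: RR] (g n) by apply: mI; exact: mmol.
have g0 n t : (0 <= g n t)%E by exact: (I0 (fun t x => mol w n t x + mol W n t x)).
apply: (@le_trans _ _ (\int[mu]_t limn_einf (g^~ t))%E).
  apply: ge0_le_integral => //.
  - by move=> t _; exact: (I0 (fun t x => w t x + W t x)).
  - exact: mI.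
  - exact: measurable_limn_einf.
  move=> t _.
  apply: (fatou_ae (X := RR) (f := fun n x => ((mol w n t x + mol W n t x) ^+ 2)%:E)).
  - by move=> n; apply: mS; exact: mmol.
  - by move=> n x; rewrite lee_fin sqr_ge0.
  - exact: mS.
  - by move=> x; rewrite lee_fin sqr_ge0.
  have cW_ae := mol_cvg t mW W_le; have cw_ae := mol_cvg t mw w_le.
  have Fae := ae_filter_ringOfSetsType mu.
  apply: filterS2 cw_ae cW_ae => x cw cW.
  apply: cvg_EFin; first exact: nearW.
  rewrite expr2; under eq_fun do rewrite expr2.
  by apply: cvgM; apply: cvgD.
apply: le_trans (fatou mu measurableT mg (fun n t _ => g0 n t)) _.
by apply: limn_einf_le => n; exact: sum_bound.
Qed.

(** By [sum_sqr_le] the integral of w W is at most 0; as the integrand is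
    nonnegative, it vanishes almost everywhere. *)
Lemma product_ae0 : (forall t x, 0 <= w t x * W t x) ->
  {ae (mu \x mu)%E, forall z, w z.1 z.2 * W z.1 z.2 = 0}.
Proof.
move=> wW0.
have mwW : measurable_fun [set: RR * RR] (fun z => w z.1 z.2 * W z.1 z.2).
  exact: measurable_funM.
have mw2 : measurable_fun [set: RR * RR] (fun z => (w z.1 z.2 ^+ 2)%:E).
  by apply/measurable_EFinP; exact: measurable_funX.
have mW2 : measurable_fun [set: RR * RR] (fun z => (W z.1 z.2 ^+ 2)%:E).
  by apply/measurable_EFinP; exact: measurable_funX.
have := sum_sqr_le.
rewrite (iter_plane (f := fun t x => w t x + W t x)); last exact: measurable_funD.
rewrite (iter_plane mw) (iter_plane mW).
have -> : (\int[(mu \x mu)%E]_z ((w z.1 z.2 + W z.1 z.2) ^+ 2)%:E =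
    (\int[(mu \x mu)%E]_z (w z.1 z.2 ^+ 2)%:E + \int[(mu \x mu)%E]_z (W z.1 z.2 ^+ 2)%:E) +
    \int[(mu \x mu)%E]_z (2 * (w z.1 z.2 * W z.1 z.2))%:E)%E.
  rewrite -!ge0_integralD//.
  - apply: eq_integral => z _; rewrite -!EFinD; congr EFin; ring.
  - by move=> z _; rewrite adde_ge0// lee_fin sqr_ge0.
  - exact: emeasurable_funD.
  - by move=> z _; rewrite lee_fin mulr_ge0.
  - by apply/measurable_EFinP; exact: measurable_funM.
  - by move=> z _; rewrite lee_fin sqr_ge0.
  - by move=> z _; rewrite lee_fin sqr_ge0.
set I := (\int[(mu \x mu)%E]_z (w z.1 z.2 ^+ 2)%:E + \int[(mu \x mu)%E]_z (W z.1 z.2 ^+ 2)%:E)%E.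
have Ifin : I \is a fin_num.
  rewrite ge0_fin_numE; last first.
    by apply: adde_ge0; apply: integral_ge0 => z _; rewrite lee_fin sqr_ge0.
  by apply: lte_add_pinfty; rewrite -iter_plane.
rewrite -[leRHS]adde0 leeD2lE// => H.
have H0 : (\int[(mu \x mu)%E]_z `|(2 * (w z.1 z.2 * W z.1 z.2))%:E| = 0)%E.
  apply/eqP; rewrite eq_le integral_ge0 ?andbT//.
  apply: le_trans H; rewrite le_eqVlt; apply/orP; left; apply/eqP.
  by apply: eq_integral => z _; rewrite gee0_abs// lee_fin mulr_ge0.
have m2 : measurable_fun [set: RR * RR] (fun z => (2 * (w z.1 z.2 * W z.1 z.2))%:E).
  by apply/measurable_EFinP; exact: measurable_funM.
have Fae := ae_filter_ringOfSetsType (mu \x mu)%E.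
have /(ae_eq_integral_abs _ measurableT m2) := H0.
by apply: filterS => z /(_ Logic.I) [] /eqP; rewrite mulf_eq0 pnatr_eq0 /= => /eqP.
Qed.

End mollified_product.

(** * Uniqueness *)

Section uniqueness_tools.
Context {R : realType}.
Local Notation mu := (@lebesgue_measure R).
Local Notation RR := (measurableTypeR R).

(** The constant is positive if some real number satisfies its defining property,
    and otherwise it is the default value 0. *)
Lemma jump_constant_ge0 (gamma : R) : 0 <= jump_constant gamma.
Proof.
rewrite /jump_constant; case: xgetP => [c _ [c0 _]|_]; first exact: ltW.
exact: lexx.
Qed.

Lemma convolutionB (zeta f h : R -> R) (x : R) :
  mu.-integrable [set: RR] (EFin \o zeta) ->
  measurable_fun [set: RR] f -> (forall y, `|f y| <= 1) ->
  measurable_fun [set: RR] h -> (forall y, `|h y| <= 1) ->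
  convolution zeta (fun y => f y - h y) x = convolution zeta f x - convolution zeta h x.
Proof.
move=> iz mf f1 mh h1; rewrite /convolution -RintegralB//; last 2 first.
- exact: (integrable_convolution_integrand iz x mf f1).
- exact: (integrable_convolution_integrand iz x mh h1).
by apply: eq_Rintegral => y _; rewrite mulrBl.
Qed.

Lemma time_space_L2_dominated (f a c : R -> R -> R) (K : R) :
  measurable_fun [set: RR * RR] (fun z => f z.1 z.2) ->
  measurable_fun [set: RR * RR] (fun z => a z.1 z.2) ->
  measurable_fun [set: RR * RR] (fun z => c z.1 z.2) ->
  (\int[mu]_t \int[mu]_x (a t x ^+ 2)%:E < +oo)%E ->
  (\int[mu]_t \int[mu]_x (c t x ^+ 2)%:E < +oo)%E ->
  (forall t x, f t x ^+ 2 <= K * (a t x ^+ 2 + c t x ^+ 2)) ->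
  (\int[mu]_t \int[mu]_x (f t x ^+ 2)%:E < +oo)%E.
Proof.
move=> mf ma mc a2 c2 fac.
have iac : (mu \x mu)%E.-integrable [set: RR * RR]
    (EFin \o (fun z => K * (a z.1 z.2 ^+ 2 + c z.1 z.2 ^+ 2))).
  have := integrableD measurableT (integrable_sqr_time_space ma a2) (integrable_sqr_time_space mc c2).
  by move/(integrableZl measurableT K); apply: eq_integrable.
have mf2 : measurable_fun [set: RR * RR] (fun z => f z.1 z.2 ^+ 2) by exact: measurable_funX.
have if2 : (mu \x mu)%E.-integrable [set: RR * RR] (EFin \o (fun z => f z.1 z.2 ^+ 2)).
  apply: (integrable_dominated (X := (RR * RR)%type) mf2 _ iac) => z.
  by rewrite ger0_norm ?sqr_ge0.
rewrite -(@fubini_tonelli1 _ _ RR RR _ mu mu (fun z => (f z.1 z.2 ^+ 2)%:E)).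
- exact: (integrable_lty measurableT if2).
- exact/measurable_EFinP.
- by move=> z; rewrite lee_fin sqr_ge0.
Qed.

(** The quotient of x^n - y^n by x - y lies in [0, n] when x and y are in [0, 1]. *)
Lemma subX_factor (x y : R) (n : nat) : 0 <= x <= 1 -> 0 <= y <= 1 ->
  exists2 q, 0 <= q <= n%:R & x ^+ n - y ^+ n = (x - y) * q.
Proof.
move=> /andP[x0 x1] /andP[y0 y1]; rewrite subrXX.
exists (\sum_(i < n) x ^+ (n.-1 - i) * y ^+ i) => //; apply/andP; split.
  by apply: sumr_ge0 => i _; rewrite mulr_ge0 ?exprn_ge0.
apply: (@le_trans _ _ (\sum_(i < n) 1)); last by rewrite sumr_const card_ord.
by apply: ler_sum => i _; rewrite mulr_ile1 ?exprn_ge0 ?exprn_ile1.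
Qed.

End uniqueness_tools.

Theorem propositionC1 (R : realType) (gamma T : R) (m : nat)
    (g : R -> R) (rho1 rho2 : R -> R -> R) (b : R)
    (gamma_in : 0 < gamma < 2) (T_gt0 : 0 < T) (m_ge2 : (2 <= m)%N)
    (g_meas : measurable_fun [set: R] g)
    (g_range : forall u : R, 0 <= g u <= 1)
    (rho1_range : forall t u : R, t \in `[0, T] -> 0 <= rho1 t u <= 1)
    (rho2_range : forall t u : R, t \in `[0, T] -> 0 <= rho2 t u <= 1)
    (b_in : 0 < b < 1)
    (rho1_L2 : L2_time T L2 L2_norm (fun t u => rho1 t u - b))
    (rho2_L2 : L2_time T L2 L2_norm (fun t u => rho2 t u - b))
    (rho1_H : L2_time T (sobolev gamma) (sobolev_norm gamma)
                (fun t u => rho1 t u ^+ m - b ^+ m))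
    (rho2_H : L2_time T (sobolev gamma) (sobolev_norm gamma)
                (fun t u => rho2 t u ^+ m - b ^+ m))
    (weak1 : forall (t : R) (G : R -> R -> R), t \in `[0, T] -> test_functions G ->
               weak_F gamma m t rho1 G g = 0)
    (weak2 : forall (t : R) (G : R -> R -> R), t \in `[0, T] -> test_functions G ->
               weak_F gamma m t rho2 G g = 0) :
  {ae (@lebesgue_measure R \x @lebesgue_measure R)%E, forall z : R * R,
     z.1 \in `[0, T] -> rho1 z.1 z.2 = rho2 z.1 z.2}.
Proof.
have m_gt0 : (0 < m)%N by exact: ltnW.
have [mu1 L1] := L2_time_clip rho1_L2; have [mu2 L2] := L2_time_clip rho2_L2.
have mr1 := clip_shift mu1; have mr2 := clip_shift mu2.
pose r1 := clip T rho1; pose r2 := clip T rho2.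
have r1_in t x : 0 <= r1 t x <= 1 by exact: clip_range.
have r2_in t x : 0 <= r2 t x <= 1 by exact: clip_range.
pose w t x := r1 t x - r2 t x; pose W t x := r1 t x ^+ m - r2 t x ^+ m.
have mw : measurable_fun [set: measurableTypeR R * measurableTypeR R] (fun z => w z.1 z.2) by exact: measurable_funB.
have mr1m : measurable_fun [set: measurableTypeR R * measurableTypeR R] (fun z => r1 z.1 z.2 ^+ m) by exact: measurable_funX.
have mr2m : measurable_fun [set: measurableTypeR R * measurableTypeR R] (fun z => r2 z.1 z.2 ^+ m) by exact: measurable_funX.
have mW : measurable_fun [set: measurableTypeR R * measurableTypeR R] (fun z => W z.1 z.2) by exact: measurable_funB.
have Xin (x : R) : 0 <= x <= 1 -> 0 <= x ^+ m <= 1.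
  by move=> /andP[x0 x1]; rewrite exprn_ge0// exprn_ile1.
have B_le (x y : R) : 0 <= x <= 1 -> 0 <= y <= 1 -> `|x - y| <= 1.
  by move=> /andP[? ?] /andP[? ?]; rewrite ler_norml; apply/andP; split; lra.
have w_le t x : `|w t x| <= 1 by exact: B_le.
have W_le t x : `|W t x| <= 1 by apply: B_le; exact: Xin.
have W_supp t x : ~~ (0 <= t <= T) -> W t x = 0.
  by move=> tT; rewrite /W /r1 /r2 !clip_out// subrr.
have wE t x : w t x = clip T (fun t u => rho1 t u - b) t x - clip T (fun t u => rho2 t u - b) t x.
  by rewrite /w /r1 /r2 /clip; case: ifP => _; ring.
have w2 t x : w t x ^+ 2 <= 2 * (clip T (fun t u => rho1 t u - b) t x ^+ 2 +
    clip T (fun t u => rho2 t u - b) t x ^+ 2).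
  rewrite wE; move: (clip _ _ _ _) (clip _ _ _ _) => a c.
  by have := sqr_ge0 (a + c); nra.
have wW t x : exists2 q, 0 <= q <= m%:R & W t x = w t x * q by exact: subX_factor.
have w_L2 := time_space_L2_dominated mw mu1 mu2 L1 L2 w2.
have W_L2 : (\int[@lebesgue_measure R]_t \int[@lebesgue_measure R]_x (W t x ^+ 2)%:E < +oo)%E.
  apply: (time_space_L2_dominated (K := m%:R ^+ 2) mW mw mw w_L2 w_L2) => t x.
  have [q /andP[q0 qm] ->] := wW t x; rewrite exprMn mulrC.
  apply: ler_pM; rewrite ?sqr_ge0//; last by rewrite lerDl sqr_ge0.
  by rewrite lerXn2r ?nnegrE// ler0n.
have wW_ge0 t x : 0 <= w t x * W t x.
  by have [q /andP[q0 _] ->] := wW t x; rewrite mulrA -expr2 mulr_ge0// sqr_ge0.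
have C_ge0 : 0 <= jump_constant gamma / 2 by rewrite divr_ge0 ?jump_constant_ge0.
have energy n : \int[(@lebesgue_measure R \x @lebesgue_measure R)%E]_z
    (convolution (mollifier n.+1%:R^-1) (w z.1) z.2 *
     convolution (mollifier n.+1%:R^-1) (W z.1) z.2) <= 0.
  pose r : R := n.+1%:R^-1; rewrite -/r.
  have r0 : 0 < r by rewrite invr_gt0.
  have iz := integrable_mollifier r0.
  have iN := integrable_mollified_laplacian gamma_in r0.
  have z_le x : `|mollifier r x| <= expR 4 / r.
    by rewrite ger0_norm ?mollifier_ge0// mollifier_le.
  have z_supp x : r < `|x| -> mollifier r x = 0.
    by move=> xr; rewrite mollifier_supp// ltW.
  have [C2 C20 HC2] := flat_algebra_second_difference (mollifier_flat_algebra r) z_le z_supp.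
  have slice (f : R -> R -> R) s : measurable_fun [set: measurableTypeR R * measurableTypeR R] (fun z => f z.1 z.2) ->
      measurable_fun [set: measurableTypeR R] (f s).
    by move=> mf; exact: (measurableT_comp mf (measurable_pair1 s)).
  have n1 (x : R) : 0 <= x <= 1 -> `|x| <= 1.
    by move=> /andP[x0 x1]; rewrite ger0_norm.
  have ip : (@lebesgue_measure R).-integrable [set: measurableTypeR R] (EFin \o (fun h => (C2 + 4 * (expR 4 / r)) * levy_weight gamma h)).
    have := integrable_levy_weight gamma_in.
    by move/(integrableZl measurableT (C2 + 4 * (expR 4 / r))); apply: eq_integrable.
  apply: (energy_le0 (om := fun t x => convolution (mollifier r) (w t) x)
    (Om := fun t x => convolution (mollifier r) (W t) x) (ltW T_gt0) mW W_le W_supp W_L2 iz (fun _ _ => erefl)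
    (measurable_convolution_time mW iz) (convolution_time_le mW W_le iz)
    (convolution_time_supp _ W_supp) (convolution_time_L2_fin mW W_L2 iz)
    (measurable_jump_kernel gamma) (jump_kernel_ge0 gamma) ip
    (second_difference_le _ z_le C20 HC2)
    (integrable_second_difference gamma_in iz z_le z_supp C20 HC2) C_ge0) => t x tT.
  rewrite (convolutionB x iz (slice _ t mr1) (fun y => n1 _ (r1_in t y))
    (slice _ t mr2) (fun y => n1 _ (r2_in t y))).
  rewrite (mollified_weak_equation gamma_in m_gt0 r0 mr1 rho1_range weak1)//.
  rewrite (mollified_weak_equation gamma_in m_gt0 r0 mr2 rho2_range weak2)//.
  rewrite opprD addrACA subrr add0r -mulrBr; congr (_ * _).
  have i1 := integrable_convolution_power gamma_in m_gt0 r0 mr1 rho1_range x.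
  have i2 := integrable_convolution_power gamma_in m_gt0 r0 mr2 rho2_range x.
  rewrite -RintegralB//; last 2 first.
  - by apply: (integrableS _ _ _ i1).
  - by apply: (integrableS _ _ _ i2).
  apply: eq_Rintegral => s _; apply/esym.
  exact: (convolutionB x iN (slice (fun s y => r1 s y ^+ m) s mr1m) (fun y => n1 _ (Xin _ (r1_in s y)))
    (slice (fun s y => r2 s y ^+ m) s mr2m) (fun y => n1 _ (Xin _ (r2_in s y)))).
have Fae := ae_filter_ringOfSetsType (@lebesgue_measure R \x @lebesgue_measure R)%E.
have := product_ae0 mw mW w_le W_le w_L2 W_L2 energy wW_ge0.
apply: filterS => z wW0; rewrite in_itv /= => zT.
have E1 : r1 z.1 z.2 = rho1 z.1 z.2 by exact: clip_in.
have E2 : r2 z.1 z.2 = rho2 z.1 z.2 by exact: clip_in.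
rewrite -E1 -E2; move/eqP : wW0; rewrite mulf_eq0 !subr_eq0 => /orP[/eqP//|/eqP].
by have /andP[a0 _] := r1_in z.1 z.2; have /andP[c0 _] := r2_in z.1 z.2;
  move/(pexpIrn m_gt0) => /(_ a0 c0).
Qed.
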